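(* Let $d\in\mathbb{N}$, let $p$ be a kernel on $\mathbb{Z}^d$ as in the context, and let $\xi=\{\xi_t(x)\}_{t\in\mathbb{Z},x\in\mathbb{Z}^d}$ be i.i.d. real random variables with mean zero and variance $\sigma_\xi^2<\infty$, with law $\mathbb{P}$. For $x,y\in\mathbb{Z}^d$, $t\in\mathbb{Z}$ define \[\Delta_t(x,y)=\sum_{k=0}^\infty\sum_{z\in\mathbb{Z}^d}\xi_{t-k}(z)\bigl(p^k(y,z)-p^k(x,z)\bigr).\] Then this series converges for $\mathbb{P}$-almost every $\xi$ and in $L^2(\mathbb{P})$. For almost every $\xi$, the variables satisfy the additivity $\Delta_t(x,y)+\Delta_t(y,z)=\Delta_t(x,z)$ for all $x,y,z$ and the evolution equation \[\Delta_{t+1}(x,y)=\sum_z p(0,z)\Delta_t(x+z,y+z)+\xi_{t+1}(y)-\xi_{t+1}(x),\quad x,y\in\mathbb{Z}^d,\ t\in\mathbb{Z}.\] Setting $\Delta_t(x)=(\Delta_t(x-e_i,x))_{i=1}^d\in\mathbb{R}^d$ and $\Delta_t=\{\Delta_t(x)\}_{x\in\mathbb{Z}^d}$, the process $\{\Delta_t\}_{t\in\mathbb{Z}}$ is a stationary version of the Markov chain on $(\mathbb{R}^d)^{\mathbb{Z}^d}$ given by \[\eta_{t+1}(x-e_i,x)=\sum_z p(0,z)\eta_t(x+z-e_i,x+z)+\xi_{t+1}(x)-\xi_{t+1}(x-e_i),\quad x\in\mathbb{Z}^d,\ i=1,\dots,d,\] and the random field $\{\Delta_t(x)\}_{t\in\mathbb{Z},x\in\mathbb{Z}^d}$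 is invariant and ergodic under each individual space-time shift $\theta_{x,t}$ with $(x,t)\ne(0,0)$.
   Context: The kernel $p:\mathbb{Z}^d\to[0,1)$ satisfies $\sum_x p(x)=1$, $p(x)=0$ for $|x|>M$ for some $M<\infty$, and strong aperiodicity: for every $u\in\mathbb{Z}^d$ the smallest additive subgroup of $\mathbb{Z}^d$ containing $\{u+x:p(x)>0\}$ is $\mathbb{Z}^d$. $p(x,y)=p(y-x)$, $p^0(x,y)=\mathbf{1}_{x=y}$ and $p^k$ is the $k$-step transition probability. $e_i$ are the standard unit vectors. The space-time shift $\theta_{x,t}$ acts on space-time indexed fields by $(\theta_{x,t}\omega)_s(y)=\omega_{s+t}(y+x)$; in the Markov chain, $\xi_{t+1}=\{\xi_{t+1}(x)\}_x$ is independent of $\eta_t$. *)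

(* Defs.v *)
From HB Require Import structures.
From mathcomp Require Import all_boot all_order all_algebra.
From mathcomp Require Import all_classical all_reals all_analysis.
Set Implicit Arguments. Unset Strict Implicit. Unset Printing Implicit Defensive.
Import Order.TTheory GRing.Theory Num.Theory.
Import numFieldNormedType.Exports.
Local Open Scope classical_set_scope.
Local Open Scope ring_scope.

Notation Zd dim := ('rV[int]_dim).

Definition unitv (dim : nat) (i : 'I_dim) : Zd dim := delta_mx 0 i.

Definition supn (dim : nat) (x : Zd dim) : nat := (\max_(i < dim) `|x ord0 i|)%N.

Definition gen_subgroup (dim : nat) (S : set (Zd dim)) : set (Zd dim) :=
  [set y | forall G : set (Zd dim),
     G 0 -> (forall a b, G a -> G b -> G (a - b)) -> S `<=` G -> G y].

Definition good_kernel (R : realType) (dim : nat) (p : Zd dim -> R) : Prop :=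
  [/\ forall x, 0 <= p x < 1,
      \sum_(x \in [set: Zd dim]) p x = 1,
      exists M : nat, forall x, (M < supn x)%N -> p x = 0
    & forall u : Zd dim,
        gen_subgroup [set u + x | x in [set x | 0 < p x]] = [set: Zd dim]].

(* k-step transition probability p^k(x,y), with p(x,y) = p(y - x). *)
Fixpoint pk (R : realType) (dim : nat) (p : Zd dim -> R) (k : nat)
    (x y : Zd dim) : R :=
  match k with
  | 0 => (x == y)%:R
  | k'.+1 => \sum_(z \in [set: Zd dim]) p (z - x) * pk p k' z y
  end.

Section Prob.
Context (dT : measure_display) (T : measurableType dT) (R : realType).
Variable P : probability T R.

Definition mutually_independent (I : eqType) (X : I -> T -> R) : Prop :=
  forall (J : seq I) (B : I -> set R), uniq J -> (forall i, measurable (B i)) ->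
    P (\big[setI/setT]_(i <- J) (X i @^-1` B i)) =
    (\prod_(i <- J) P (X i @^-1` B i))%E.

Definition identically_distributed (I : Type) (X : I -> T -> R) : Prop :=
  forall i j (B : set R), measurable B -> P (X i @^-1` B) = P (X j @^-1` B).

Definition cyl_sigma (I : Type) : set (set (I -> R)) :=
  <<s [set C | exists (j : I) (B : set R), measurable B /\ C = [set f | B (f j)]] >>.

Definition indep_fields (I1 I2 : Type) (X : T -> I1 -> R) (Y : T -> I2 -> R) : Prop :=
  forall A B, cyl_sigma A -> cyl_sigma B ->
    P (X @^-1` A `&` Y @^-1` B) = (P (X @^-1` A) * P (Y @^-1` B))%E.

End Prob.

Definition Delta_partial (dT : measure_display) (T : measurableType dT)
  (R : realType) (dim : nat) (p : Zd dim -> R) (xi : int -> Zd dim -> T -> R)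
  (t : int) (x y : Zd dim) (n : nat) (w : T) : R :=
  \sum_(k < n) \sum_(z \in [set: Zd dim])
      xi (t - k%:Z) z w * (pk p k y z - pk p k x z).

Definition Delta (dT : measure_display) (T : measurableType dT)
  (R : realType) (dim : nat) (p : Zd dim -> R) (xi : int -> Zd dim -> T -> R)
  (t : int) (x y : Zd dim) (w : T) : R :=
  limn (fun n => Delta_partial p xi t x y n w).

Definition Delta_field (dT : measure_display) (T : measurableType dT)
  (R : realType) (dim : nat) (p : Zd dim -> R) (xi : int -> Zd dim -> T -> R)
  (w : T) : int * Zd dim * 'I_dim -> R :=
  fun j => Delta p xi j.1.1 (j.1.2 - unitv j.2) j.1.2 w.

Definition st_shift (R : realType) (dim : nat) (x : Zd dim) (t : int)
  (F : int * Zd dim * 'I_dim -> R) : int * Zd dim * 'I_dim -> R :=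
  fun j => F (j.1.1 + t, j.1.2 + x, j.2).

(* Main.v *)
(** Write q_k(z) = p^k(0,z). Since q_(k+1) is the p-average of the translates of q_k, which
    all have the same l^2 norm, the variance identity turns |q_k|^2 - |q_(k+1)|^2 into
    (1/2) sum_(v,w) p(v) p(w) |q_k(. - v) - q_k(. - w)|^2. Telescoping in k, the set of u with
    sum_k |q_k - q_k(. - u)|^2 < oo contains the differences of points of the support of p;
    it is a subgroup, hence all of Z^d by strong aperiodicity. So the layers of the series for
    Delta_t(x,y) are independent, centred, with summable variances: Ottaviani's inequality
    gives almost sure convergence and Fatou's lemma convergence in L^2. Additivity and the
    evolution equation hold for partial sums and pass to the limit. Finally the field Delta is
    a measurable function of xi that commutes exactly with space-time shifts, so invariance
    and ergodicity are inherited from the i.i.d. field xi, which is mixing under each shift. *)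

Require Import Defs.
From HB Require Import structures.
From mathcomp Require Import all_boot all_order all_algebra finmap.
From mathcomp Require Import all_classical all_reals all_analysis.
From mathcomp Require Import measurable_realfun.
From mathcomp Require Import ring lra zify.
Set Implicit Arguments. Unset Strict Implicit. Unset Printing Implicit Defensive.
Import Order.TTheory GRing.Theory Num.Theory.
Import numFieldNormedType.Exports.
Local Open Scope classical_set_scope.
Local Open Scope ring_scope.

(** * Finitely supported sums *)

(** Differences are essential: in dimensions one and two the sum of |q_k|^2 diverges, so for
    nondegenerate noise the series attached to a single site has infinite variance. Dissipation
    bounds the energies of differences in every dimension without any estimate on p^k. Ergodicity
    concerns exactly invariant sets, so the shift relation for Delta must hold at every noise
    configuration and not merely almost everywhere. This is possible because a limit that does not
    exist has a fixed default value: Delta is then a total, measurable function of the noise.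
    Statements about laws are reduced to finite rectangles. A nonzero shift eventually moves any
    finite set of coordinates off any other one, so on rectangles mixing becomes an exact product
    formula after finitely many steps. *)

Section FiniteSupport.
Context {R : idomainType} {T : choiceType}.

(** A sum over all of [T] takes the default value 0 when the support is infinite, so additivity and
    exchange of sums require this predicate. *)
Definition fsupp (f : T -> R) := finite_set (f @^-1` [set~ 0]).

Lemma fsupp_le (f : T -> R) (A : set T) :
  finite_set A -> (forall x, ~ A x -> f x = 0) -> fsupp f.
Proof.
move=> fA h; apply: (sub_finite_set _ fA) => x /= fx.
by apply: contrapT => /h.
Qed.

Lemma fsuppD (f g : T -> R) : fsupp f -> fsupp g -> fsupp (f \+ g).
Proof.
move=> ff fg; apply: (@fsupp_le _ (f @^-1` [set~ 0] `|` g @^-1` [set~ 0])).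
  by rewrite finite_setU.
by move=> x /not_orP[/= /contrapT f0 /contrapT g0]; rewrite f0 g0 addr0.
Qed.

Lemma fsuppMl (f g : T -> R) : fsupp f -> fsupp (fun x => g x * f x).
Proof.
by move=> ff; apply: (fsupp_le ff) => x /= /contrapT ->; rewrite mulr0.
Qed.

Lemma fsuppN (f : T -> R) : fsupp f -> fsupp (\- f).
Proof.
by move=> ff; apply: (fsupp_le ff) => x /= /contrapT ->; rewrite oppr0.
Qed.

Lemma fsuppB (f g : T -> R) : fsupp f -> fsupp g -> fsupp (f \- g).
Proof. by move=> ff /fsuppN; exact: fsuppD. Qed.

Lemma fsuppX (f : T -> R) : fsupp f -> fsupp (fun x => f x ^+ 2).
Proof. by move=> ff; exact: fsuppMl. Qed.

Lemma fsupp_sum (I : Type) (r : seq I) (F : I -> T -> R) :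
  (forall i, fsupp (F i)) -> fsupp (fun x => \sum_(i <- r) F i x).
Proof.
move=> hF; elim: r => [|i r IH].
  by apply: (@fsupp_le _ set0) => // x _; rewrite big_nil.
have := fsuppD (hF i) IH.
by congr fsupp; apply/funext => x; rewrite big_cons.
Qed.

Lemma fsum_fset (A : set T) (f : T -> R) :
  finite_set A -> (forall x, ~ A x -> f x = 0) ->
  \sum_(x \in [set: T]) f x = \sum_(x <- fset_set A) f x.
Proof.
move=> fA h; apply: fsbigTE => x.
by rewrite in_fset_set// => /negP; rewrite inE; exact: h.
Qed.

Lemma fsumD (f g : T -> R) : fsupp f -> fsupp g ->
  \sum_(x \in [set: T]) (f x + g x) =
  \sum_(x \in [set: T]) f x + \sum_(x \in [set: T]) g x.
Proof.
move=> ff fg; set A := f @^-1` [set~ 0] `|` g @^-1` [set~ 0].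
have fA : finite_set A by rewrite finite_setU.
have f0 x : ~ A x -> f x = 0 by move=> /not_orP[/= /contrapT].
have g0 x : ~ A x -> g x = 0 by move=> /not_orP[_ /= /contrapT].
rewrite !(fsum_fset fA)// ?big_split//.
by move=> x Ax; rewrite f0// g0// addr0.
Qed.

Lemma fsumN (f : T -> R) :
  \sum_(x \in [set: T]) - f x = - \sum_(x \in [set: T]) f x.
Proof.
rewrite -mulN1r mulr_fsumr; apply: eq_fsbigr => x _; by rewrite mulN1r.
Qed.

Lemma fsumB (f g : T -> R) : fsupp f -> fsupp g ->
  \sum_(x \in [set: T]) (f x - g x) =
  \sum_(x \in [set: T]) f x - \sum_(x \in [set: T]) g x.
Proof. by move=> ff fg; rewrite fsumD ?fsumN//; exact: fsuppN. Qed.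

Lemma fsum_sum (I : Type) (r : seq I) (F : I -> T -> R) :
  (forall i, fsupp (F i)) ->
  \sum_(x \in [set: T]) \sum_(i <- r) F i x =
  \sum_(i <- r) \sum_(x \in [set: T]) F i x.
Proof.
move=> hF; elim: r => [|i r IH].
  by rewrite big_nil fsbig1// => x _; rewrite big_nil.
rewrite big_cons -IH -fsumD//; last exact: fsupp_sum.
by apply: eq_fsbigr => x _; rewrite big_cons.
Qed.

End FiniteSupport.

Lemma fsum_ge0_le (R : realDomainType) (T : choiceType) (f g : T -> R) :
  fsupp f -> fsupp g -> (forall x, f x <= g x) ->
  \sum_(x \in [set: T]) f x <= \sum_(x \in [set: T]) g x.
Proof.
move=> ff fg fgl; rewrite -subr_ge0 -fsumB//.
by apply: fsumr_ge0 => x _; rewrite subr_ge0.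
Qed.

(** For two independent indices of law [p], the mean square of the difference is twice the variance;
    expanding the square leaves only products of single sums. *)
Lemma weighted_variance (R : comNzRingType) (I : Type) (r : seq I) (p a : I -> R) :
  \sum_(i <- r) p i = 1 ->
  \sum_(i <- r) \sum_(j <- r) p i * p j * (a j - a i) ^+ 2 =
  (\sum_(i <- r) p i * a i ^+ 2 - (\sum_(i <- r) p i * a i) ^+ 2) *+ 2.
Proof.
move=> p1.
have E : forall i, \sum_(j <- r) p i * p j * (a j - a i) ^+ 2 =
   p i * (\sum_(j <- r) p j * a j ^+ 2) + p i * a i ^+ 2 * (\sum_(j <- r) p j)
   - (p i * a i) * (\sum_(j <- r) p j * a j) *+ 2.
  move=> i; rewrite !mulr_sumr -sumrMnl -!big_split -sumrB/=.
  by apply: eq_bigr => j _; ring.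
rewrite (eq_bigr _ (fun i _ => E i)) sumrB big_split/= -!mulr_suml sumrMnl.
by rewrite -mulr_suml p1; ring.
Qed.

Lemma supn_finite (dim M : nat) : finite_set [set x : Zd dim | (supn x <= M)%N].
Proof.
(* Coordinates in [-M, M] are shifted by [M] into an ordinal of size 2M + 1, so the ball lies in the
   image of a finite type. *)
pose f (y : 'rV['I_(M.*2.+1)]_dim) : Zd dim := map_mx (fun i : 'I_(M.*2.+1) => (i : nat)%:Z - M%:Z) y.
apply: (@sub_finite_set _ _ (range f)); last exact: finite_image.
move=> x /= hx; exists (map_mx (fun a : int => inord (absz (a + M%:Z))) x) => //.
apply/rowP => i.
have : (absz (x 0%R i) <= M)%N.
  by apply: leq_trans hx; exact: (leq_bigmax (F := fun i => absz (x ord0 i))).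
by rewrite !mxE; set a : int := x _ i => ha; rewrite inordK; lia.
Qed.

(** * Summability of the energies of the kernel *)

Section Kernel.
Context {R : realType} {dim : nat} (p : Zd dim -> R).
Hypothesis hp : good_kernel p.

Lemma kernel_ge0 x : 0 <= p x.
Proof. by case: hp => /(_ x)/andP[]. Qed.

Lemma kernel_fsupp : fsupp p.
Proof.
case: hp => _ _ [M hM] _; apply: (fsupp_le (supn_finite dim M)) => x /negP.
by rewrite -ltnNge; exact: hM.
Qed.

Definition ksupp : seq (Zd dim) := fset_set (p @^-1` [set~ 0]).

Lemma kernel_sumE (F : Zd dim -> R) :
  \sum_(z \in [set: Zd dim]) p z * F z = \sum_(z <- ksupp) p z * F z.
Proof.
apply: fsum_fset => [|x /= /contrapT ->]; last by rewrite mul0r.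
exact: kernel_fsupp.
Qed.

Lemma kernel_sum1 : \sum_(z <- ksupp) p z = 1.
Proof.
case: hp => _ <- _ _; apply/esym/fsum_fset; first exact: kernel_fsupp.
by move=> x /= /contrapT.
Qed.

(** Summing over the increment [w] instead of the intermediate site makes the range of summation
    independent of [x]. *)
Lemma pkS k x y : pk p k.+1 x y = \sum_(w <- ksupp) p w * pk p k (x + w) y.
Proof.
rewrite -kernel_sumE /= (reindex_fsbigT (fun w => x + w)).
  by apply: eq_fsbigr => w _; rewrite addrC addKr.
by exists (fun z => - x + z) => z; rewrite ?addKr ?addNKr.
Qed.

Lemma pk_shift k x y a : pk p k (x + a) (y + a) = pk p k x y.
Proof.
elim: k x => [|k IH] x; first by rewrite /= (inj_eq (addIr a)).
by rewrite !pkS; apply: eq_bigr => w _; rewrite addrAC IH.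
Qed.

Lemma pk_fsupp k x : fsupp (pk p k x).
Proof.
elim: k x => [|k IH] x.
  apply: (@fsupp_le _ _ _ [set x]); first exact: finite_set1.
  by move=> y /eqP; rewrite /= eq_sym => /negPf ->.
have := @fsupp_sum _ _ _ ksupp (fun w y => p w * pk p k (x + w) y)
  (fun w => fsuppMl (fun=> p w) (IH (x + w))).
by congr fsupp; apply/funext => y; rewrite -pkS.
Qed.

Lemma shift_bij (a : Zd dim) : bijective (fun z : Zd dim => z + a).
Proof. by exists (fun z => z - a) => z; rewrite ?addrK ?subrK. Qed.

Definition pk_sqnorm k x : R := \sum_(z \in [set: Zd dim]) pk p k x z ^+ 2.

(** Up to the variance of the noise, this is the variance of the [k]-th layer of the series for
    Delta. *)
Definition pk_energy k x y : R :=
  \sum_(z \in [set: Zd dim]) (pk p k y z - pk p k x z) ^+ 2.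

Lemma pk_sqnorm_ge0 k x : 0 <= pk_sqnorm k x.
Proof. by apply: fsumr_ge0 => z _; exact: sqr_ge0. Qed.

Lemma pk_energy_ge0 k x y : 0 <= pk_energy k x y.
Proof. by apply: fsumr_ge0 => z _; exact: sqr_ge0. Qed.

Lemma pk_sqnorm_shift k x a : pk_sqnorm k (x + a) = pk_sqnorm k x.
Proof.
rewrite /pk_sqnorm (reindex_fsbigT _ _ (shift_bij a)).
by apply: eq_fsbigr => z _; rewrite pk_shift.
Qed.

Lemma pk_energy_shift k x y a : pk_energy k (x + a) (y + a) = pk_energy k x y.
Proof.
rewrite /pk_energy (reindex_fsbigT _ _ (shift_bij a)).
by apply: eq_fsbigr => z _; rewrite !pk_shift.
Qed.

Lemma pk_energyC k x y : pk_energy k x y = pk_energy k y x.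
Proof. by apply: eq_fsbigr => z _; rewrite -opprB sqrrN. Qed.

Lemma pk_diff_fsupp k x y : fsupp (fun z => pk p k y z - pk p k x z).
Proof. by apply: fsuppB; exact: pk_fsupp. Qed.

Lemma pk_energy_triangle k x y z :
  pk_energy k x z <= pk_energy k x y *+ 2 + pk_energy k y z *+ 2.
Proof.
have fE a b : fsupp (fun z => (pk p k b z - pk p k a z) ^+ 2).
  by apply: fsuppX; exact: pk_diff_fsupp.
rewrite -[X in _ <= X + _]mulr_natl -[X in _ <= _ + X]mulr_natl !mulr_fsumr -fsumD; [|exact: fsuppMl..].
apply: fsum_ge0_le => [//||w]; first by apply: fsuppD; exact: fsuppMl.
set a := pk p k x w; set b := pk p k y w; set c := pk p k z w.
(* This square is exactly the gap 2(b - a)^2 + 2(c - b)^2 - (c - a)^2. *)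
by have := sqr_ge0 (a + c - 2 * b); nra.
Qed.

(* The variance of w |-> pk k w z under p, summed over z, telescopes in k because
   pk k w has the same l2 norm for every w and averages to pk (k+1) 0. *)
Lemma pk_energy_dissipation k :
  \sum_(v <- ksupp) \sum_(w <- ksupp) p v * p w * pk_energy k v w =
  (pk_sqnorm k 0 - pk_sqnorm k.+1 0) *+ 2.
Proof.
have fE v w : fsupp (fun z => p v * p w * (pk p k w z - pk p k v z) ^+ 2).
  by apply: fsuppMl; apply: fsuppX; exact: pk_diff_fsupp.
have fS v : fsupp (fun z => p v * pk p k v z ^+ 2).
  by apply: fsuppMl; apply: fsuppX; exact: pk_fsupp.
transitivity (\sum_(z \in [set: Zd dim])
    (\sum_(v <- ksupp) p v * pk p k v z ^+ 2 - pk p k.+1 0 z ^+ 2) *+ 2).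
  under eq_bigr => v _ do under eq_bigr => w _ do rewrite mulr_fsumr.
  under eq_bigr => v _ do rewrite -fsum_sum//.
  rewrite -fsum_sum; last by move=> v; exact: fsupp_sum.
  apply: eq_fsbigr => z _; rewrite weighted_variance ?kernel_sum1// pkS.
  by congr ((_ - _ ^+ 2) *+ 2); apply: eq_bigr => w _; rewrite add0r.
under eq_fsbigr => z _ do rewrite -mulr_natl.
rewrite -mulr_fsumr mulr_natl; congr (_ *+ 2).
rewrite fsumB; [|exact: fsupp_sum|by apply: fsuppX; exact: pk_fsupp].
congr (_ - _); rewrite fsum_sum//.
under eq_bigr => v _ do rewrite -mulr_fsumr -/(pk_sqnorm k v) -[v]add0r pk_sqnorm_shift add0r.
by rewrite -mulr_suml kernel_sum1 mul1r.
Qed.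

Definition summable_energy x y :=
  exists C : R, forall n, \sum_(k < n) pk_energy k x y <= C.

(** The dissipation at each step is a sum of nonnegative terms, one of which is the energy of the
    pair [v], [w] with weight [p v * p w]. The telescoped total is at most twice the initial squared
    norm, whence the constant. *)
Lemma summable_energy_supp v w : 0 < p v -> 0 < p w -> summable_energy v w.
Proof.
move=> pv pw; exists ((p v * p w)^-1 * (pk_sqnorm 0 0 *+ 2)) => n.
rewrite ler_pdivlMl ?mulr_gt0//.
have inS x : 0 < p x -> x \in ksupp.
  by move=> px; rewrite in_fset_set ?inE//=; [exact/eqP/lt0r_neq0|exact: kernel_fsupp].
have pp_ge0 a b : 0 <= p a * p b by rewrite mulr_ge0 ?kernel_ge0.
have le1 (F : Zd dim -> R) x : (forall y, 0 <= F y) -> x \in ksupp ->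
    F x <= \sum_(y <- ksupp) F y.
  move=> F0 xS; rewrite (bigD1_seq x)//= ?fset_uniq// lerDl.
  by apply: sumr_ge0 => y _.
apply: (@le_trans _ _ (\sum_(k < n) (pk_sqnorm k 0 - pk_sqnorm k.+1 0) *+ 2)).
  rewrite mulr_sumr; apply: ler_sum => k _; rewrite -pk_energy_dissipation.
  pose F a := \sum_(w <- ksupp) p a * p w * pk_energy k a w.
  apply: le_trans (le1 F v _ (inS _ pv)) => [|y].
    apply: (le1 (fun b => p v * p b * pk_energy k v b)) => [y|]; last exact: inS.
    by rewrite mulr_ge0// pk_energy_ge0.
  by apply: sumr_ge0 => z _; rewrite mulr_ge0// pk_energy_ge0.
rewrite sumrMnl lerMn2r /= -(big_mkord xpredT (fun k => pk_sqnorm k 0 - pk_sqnorm k.+1 0)).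
rewrite -[X in X <= _]opprK -sumrN.
under eq_bigr do rewrite opprB.
by rewrite telescope_sumr// opprB gerBl pk_sqnorm_ge0.
Qed.

Lemma summable_energyC x y : summable_energy x y -> summable_energy y x.
Proof.
move=> [C hC]; exists C => n; under eq_bigr do rewrite pk_energyC; exact: hC.
Qed.

Lemma summable_energy_trans x y z :
  summable_energy x y -> summable_energy y z -> summable_energy x z.
Proof.
move=> [C hC] [D hD]; exists (C *+ 2 + D *+ 2) => n.
apply: (@le_trans _ _ (\sum_(k < n) (pk_energy k x y *+ 2 + pk_energy k y z *+ 2))).
  by apply: ler_sum => k _; exact: pk_energy_triangle.
by rewrite big_split/= !sumrMnl lerD// lerMn2r /= ?hC ?hD.
Qed.

Lemma summable_energy_shift x y a :
  summable_energy x y -> summable_energy (x + a) (y + a).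
Proof.
by move=> [C hC]; exists C => n; under eq_bigr do rewrite pk_energy_shift; exact: hC.
Qed.

Lemma summable_energyT x y : summable_energy x y.
Proof.
suff G0 u : summable_energy 0 u.
  by have := summable_energy_shift x (G0 (y - x)); rewrite add0r subrK.
have [w pw] : exists w, 0 < p w.
  case: (hp) => _ s1 _ _.
  have : 0 < \sum_(x \in [set: Zd dim]) p x by rewrite s1.
  by move=> /(fsumr_gt0 [::])[w _ pw]; exists w.
(* Translating the support by [- w], with [w] in the support, turns the generators into differences
   of support points, the only pairs that dissipation controls directly. *)
case: (hp) => _ _ _ /(_ (- w)) hgen.
have : gen_subgroup [set - w + x | x in [set x | 0 < p x]] u by rewrite hgen.
apply.
- exists 0 => n; rewrite big1// => k _; rewrite /pk_energy fsbig1// => z _.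
  by rewrite subrr expr0n.
- move=> a b ha hb.
  have := summable_energy_shift (- b) (summable_energy_trans (summable_energyC hb) ha).
  by rewrite subrr.
- move=> _ [v /= pv <-].
  have := summable_energy_shift (- w) (summable_energy_supp pw pv).
  by rewrite subrr addrC.
Qed.

End Kernel.

(** * Cylinder events and independence *)

Section Cylinder.
Context {R : realType}.

Definition cyl_gen (I : Type) : set (set (I -> R)) :=
  [set C | exists (j : I) (B : set R), measurable B /\ C = [set f | B (f j)]].

(** Fields with the product sigma-algebra as a measurable type: its measurable sets are convertible
    with [cyl_sigma], so results on measurable functions apply to maps between fields. *)
Definition cylT (I : Type) := g_sigma_algebraType (@cyl_gen I).

Lemma cyl_eval (I : Type) (i : I) : measurable_fun setT (fun f : cylT I => f i).
Proof.
move=> _ B mB; rewrite setTI; apply: sub_gen_smallest.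
by exists i, B.
Qed.

Lemma measurable_cyl d (T : measurableType d) (I : Type) (h : T -> cylT I) :
  (forall i, measurable_fun setT (fun w => h w i)) -> measurable_fun setT h.
Proof.
move=> mh; refine (@measurability _ _ T (cylT I) setT h (@cyl_gen I) _ _) => //.
move=> _ [_ [i [B [mB ->]]] <-].
exact: mh.
Qed.

Lemma preimage_cyl d (T : measurableType d) (I : Type) (h : T -> I -> R)
    (A : set (I -> R)) :
  (forall i, measurable_fun setT (fun w => h w i)) -> cyl_sigma A ->
  measurable (h @^-1` A).
Proof.
by move=> mh mA; rewrite -[X in measurable X]setTI; exact: (measurable_cyl (h := h)).
Qed.

Definition rect (I : choiceType) (J : seq I) (B : I -> set R) : set (I -> R) :=
  [set f | forall i, i \in J -> B i (f i)].

(** The pi-system from which equality in law, independence and mixing are extended to all cylinder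
    events. *)
Definition rects (I : choiceType) : set (set (I -> R)) :=
  [set C | exists J B, (forall i, measurable (B i)) /\ C = @rect I J B].

Lemma rectE (I : choiceType) (J : seq I) (B : I -> set R) :
  rect J B = \big[setI/setT]_(i <- J) [set f | B i (f i)].
Proof. by rewrite -bigcap_seq; apply/seteqP; split. Qed.

Lemma rects_setI (I : choiceType) : setI_closed (@rects I).
Proof.
move=> _ _ [J [B [mB ->]]] [K [C [mC ->]]].
exists (J ++ K), (fun i => (if i \in J then B i else setT) `&`
                           (if i \in K then C i else setT)); split.
  by move=> i; apply: measurableI; case: ifP.
apply/seteqP; split=> [f [fB fC] i|f fD].
  by rewrite mem_cat; split; case: ifPn => // iJ; [exact: fB|exact: fC].
split=> i iJ; have := fD i; rewrite mem_cat iJ ?orbT => /(_ isT)[]//.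
Qed.

Lemma cyl_sigma_rects (I : choiceType) : @cyl_sigma R I = <<s @rects I >>.
Proof.
apply/seteqP; split; apply: smallest_sub; try exact: smallest_sigma_algebra.
  move=> _ [j [B [mB ->]]]; apply: sub_gen_smallest.
  exists [:: j], (fun=> B); split=> //; apply/seteqP; split=> f /= fB.
    by move=> i; rewrite inE => /eqP ->.
  by apply: fB; rewrite inE.
move=> _ [J [B [mB ->]]]; rewrite rectE.
have := @bigsetI_measurable _ (cylT I) _ J xpredT
  (fun i => [set f : I -> R | B i (f i)]).
apply=> i _; rewrite -[X in measurable X]setTI.
exact: (@cyl_eval I i measurableT _ (mB i)).
Qed.

(** When [f] is not injective, several constraints fall on the same coordinate; [C] intersects
    them. *)
Lemma rect_comp (I J : choiceType) (s : seq J) (B : J -> set R) (f : J -> I) :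
  (forall i, measurable (B i)) ->
  exists2 C : I -> set R, (forall i, measurable (C i)) &
  forall h, rect s B (h \o f) <-> rect (map f s) C h.
Proof.
move=> mB; exists (fun i => \big[setI/setT]_(j <- s | f j == i) B j).
  by move=> i; exact: bigsetI_measurable.
move=> h; split=> [hB _ /mapP[j js ->]|hC j js].
  rewrite -bigcap_seq_cond => k /= /andP[ks /eqP fk].
  by have := hB _ ks; rewrite /= fk.
have := hC (f j) (map_f f js); rewrite -bigcap_seq_cond; apply=> /=.
by rewrite js eqxx.
Qed.

End Cylinder.

Section Independence.
Context {dT : measure_display} {T : measurableType dT} {R : realType}.
Variable P : probability T R.

(** Real-valued, so that estimates can be left to real arithmetic. *)
Definition Pr (A : set T) : R := fine (P A).

Lemma prE (A : set T) : measurable A -> P A = (Pr A)%:E.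
Proof. by move=> mA; rewrite fineK// fin_num_measure. Qed.

Lemma pr_ge0 A : 0 <= Pr A. Proof. exact: fine_ge0. Qed.

Lemma prT : Pr setT = 1. Proof. by rewrite /Pr probability_setT. Qed.

Lemma prD (A B : set T) : measurable A -> measurable B ->
  Pr (A `\` B) = Pr A - Pr (A `&` B).
Proof.
move=> mA mB; rewrite /Pr measureD//; last first.
  by rewrite (le_lt_trans (probability_le1 _ _)) ?ltry.
by rewrite fineB// fin_num_measure//; exact: measurableI.
Qed.

Lemma pr_le (A B : set T) : measurable A -> measurable B -> A `<=` B ->
  Pr A <= Pr B.
Proof.
by move=> mA mB AB; rewrite fine_le ?fin_num_measure// le_measure// inE.
Qed.

(** The sets whose preimage is independent of a fixed event [E] form a Dynkin system. Keeping [E]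
    arbitrary allows the two sides of an independence statement to be extended one after the
    other. *)
Lemma indep_pi_lambda d' (S : measurableType d') (G : set (set S)) (V : T -> S)
    (E : set T) :
  @measurable _ S = <<s G >> -> setI_closed G -> measurable_fun setT V ->
  measurable E ->
  (forall B, G B -> P (E `&` V @^-1` B) = (P E * P (V @^-1` B))%E) ->
  forall B, measurable B -> P (E `&` V @^-1` B) = (P E * P (V @^-1` B))%E.
Proof.
move=> GE GI mV mE hG B; rewrite GE; move: B.
have mVp B : measurable B -> measurable (V @^-1` B).
  by move=> mB; rewrite -[X in measurable X]setTI; exact: mV.
apply: dynkin_induction => //.
- by rewrite preimage_setT setIT probability_setT mule1.
- move=> B mB hB; rewrite -preimage_setC -setDE.
  rewrite (prE (measurableD mE (mVp _ mB))) prD//; last exact: mVp.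
  rewrite -setTD (prE (measurableD measurableT (mVp _ mB))) prD//; last exact: mVp.
  rewrite setTI prE// -EFinM; congr EFin.
  move: hB; rewrite !prE//; [|exact: mVp|exact/measurableI/mVp].
  rewrite -EFinM => -[->].
  by rewrite prT mulrBr mulr1.
- move=> F mF tF hF; rewrite preimage_bigcup setI_bigcupr.
  rewrite measure_bigcup//; last 2 first.
  + by move=> i _; apply: measurableI => //; exact: mVp.
  + apply/trivIsetP => i j _ _ ij; rewrite setIACA setIid -preimage_setI.
    by move/trivIsetP : tF => ->//; rewrite preimage_set0 setI0.
  rewrite measure_bigcup//; last 2 first.
  + by move=> i _; exact: mVp.
  + apply/trivIsetP => i j _ _ ij; rewrite -preimage_setI.
    by move/trivIsetP : tF => ->//; rewrite preimage_set0.
  rewrite (@eq_eseriesr _ _ (fun i => P E * P (V @^-1` F i))%E); last first.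
    by move=> i _; exact: hF.
  by rewrite (prE mE) nneseriesZl.
Qed.

Section Family.
Context {I : choiceType} (X : I -> T -> R).
Hypothesis mX : forall i, measurable_fun setT (X i).
Hypothesis iX : mutually_independent P X.

Lemma rect_prob (J : seq I) (B : I -> set R) : uniq J ->
  (forall i, measurable (B i)) ->
  P ((fun w => X ^~ w) @^-1` rect J B) = (\prod_(i <- J) P (X i @^-1` B i))%E.
Proof.
move=> uJ mB; rewrite -iX//; congr (P _).
by rewrite -bigcap_seq; apply/seteqP; split.
Qed.

Lemma rect_undup (J : seq I) (B : I -> set R) : rect (undup J) B = rect J B.
Proof. by apply/seteqP; split=> f fB i iJ; apply: fB; rewrite ?mem_undup// -mem_undup. Qed.

Lemma rect_indep (J K : seq I) (B C : I -> set R) :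
  (forall i, measurable (B i)) -> (forall i, measurable (C i)) ->
  (forall i, i \in J -> i \notin K) ->
  P ((fun w => X ^~ w) @^-1` rect J B `&` (fun w => X ^~ w) @^-1` rect K C) =
  (P ((fun w => X ^~ w) @^-1` rect J B) * P ((fun w => X ^~ w) @^-1` rect K C))%E.
Proof.
rewrite -(rect_undup J) -(rect_undup K) => mB mC JK.
(* As [J] and [K] are disjoint, both prescriptions merge into one rectangle, to which the joint
   product formula applies. *)
pose D i := if i \in J then B i else C i.
have mD i : measurable (D i) by rewrite /D; case: ifP.
have -> : (fun w => X ^~ w) @^-1` rect (undup J) B `&`
          (fun w => X ^~ w) @^-1` rect (undup K) C =
          (fun w => X ^~ w) @^-1` rect (undup J ++ undup K) D.
  apply/seteqP; split=> [w [wB wC] i|w wD].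
    rewrite mem_cat !mem_undup /D /=; case: ifPn => [iJ _|iJ /= iK].
      by apply: wB; rewrite mem_undup.
    by apply: wC; rewrite mem_undup.
  split=> i; rewrite mem_undup => ii; have := wD i; rewrite mem_cat !mem_undup ii /D.
    by move=> /(_ isT); rewrite ii.
  by rewrite orbT => /(_ isT); case: ifPn => // /JK; rewrite ii.
rewrite !rect_prob ?undup_uniq//; last first.
  rewrite cat_uniq !undup_uniq/= andbT; apply/hasPn => i.
  by rewrite /= !mem_undup => iK; apply/negP => /JK; rewrite iK.
rewrite big_cat/=; congr (_ * _)%E; apply: eq_big_seq => i; rewrite mem_undup /D.
  by move=> ->.
by case: ifPn => // /JK /negPf ->.
Qed.

(** The pi-lambda argument is used twice, for [B] with [A] arbitrary and then for [A] with [B] a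
    rectangle. Indices may repeat inside a block, as they do below for truncated indices [minn i k];
    what matters is that the two ranges are disjoint. *)
Lemma indep_blocks (I1 I2 : choiceType) (f : I1 -> I) (g : I2 -> I) :
  (forall i j, f i != g j) ->
  indep_fields P (fun w i => X (f i) w) (fun w j => X (g j) w).
Proof.
move=> fg.
have mf (K : choiceType) (h : K -> I) : measurable_fun setT (fun w => (fun i => X (h i) w) : cylT K).
  by apply: measurable_cyl => i; exact: mX.
have mfp (K : choiceType) (h : K -> I) (A : set (K -> R)) : cyl_sigma A ->
    measurable ((fun w i => X (h i) w) @^-1` A).
  by move=> mA; apply: preimage_cyl => // i; exact: mX.
move=> A B mA mB.
apply: (@indep_pi_lambda _ (cylT I2) _ (fun w j => X (g j) w) _
  (@cyl_sigma_rects R I2) (@rects_setI R I2)) => //; first exact: mfp.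
move=> {B mB} B rB.
have mB : cyl_sigma B by rewrite cyl_sigma_rects; exact: sub_gen_smallest.
rewrite setIC muleC.
apply: (@indep_pi_lambda _ (cylT I1) _ (fun w j => X (f j) w) _
  (@cyl_sigma_rects R I1) (@rects_setI R I1)) => //; first exact: mfp.
move=> {A mA} A [J [C [mC ->]]].
case: rB => K [D [mD ->]].
have [C' mC' hC] := rect_comp J f mC.
have [D' mD' hD] := rect_comp K g mD.
have -> : (fun w i => X (f i) w) @^-1` rect J C =
   (fun w => X ^~ w) @^-1` rect (map f J) C' 
  by apply/seteqP; split=> w; [exact: (hC (X ^~ w)).1|exact: (hC (X ^~ w)).2].
have -> : (fun w i => X (g i) w) @^-1` rect K D =
   (fun w => X ^~ w) @^-1` rect (map g K) D' 
  by apply/seteqP; split=> w; [exact: (hD (X ^~ w)).1|exact: (hD (X ^~ w)).2].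
apply: rect_indep => // i /mapP[j jK ->]; apply/mapP => -[k _ /esym/eqP].
by apply/negP; exact: fg.
Qed.

End Family.

Lemma indep_fields_comp (I1 I2 J1 J2 : Type) (U : T -> I1 -> R) (V : T -> I2 -> R)
  (f : (I1 -> R) -> (J1 -> R)) (g : (I2 -> R) -> (J2 -> R)) :
  indep_fields P U V ->
  (forall A, cyl_sigma A -> cyl_sigma (f @^-1` A)) ->
  (forall A, cyl_sigma A -> cyl_sigma (g @^-1` A)) ->
  indep_fields P (f \o U) (g \o V).
Proof.
by move=> UV mf mg A B mA mB; exact: (UV _ _ (mf A mA) (mg B mB)).
Qed.

End Independence.

(** * Shifts of an i.i.d. field *)

Section PiLambda.
Context {dT : measure_display} {T : measurableType dT} {R : realType}.
Variable P : probability T R.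
Context {d' : measure_display} {S : measurableType d'} (G : set (set S)).
Hypothesis GE : @measurable _ S = <<s G >>.
Hypothesis GI : setI_closed G.

Let mpre (V : T -> S) B : measurable_fun setT V -> measurable B ->
  measurable (V @^-1` B).
Proof. by move=> mV mB; rewrite -[X in measurable X]setTI; exact: mV. Qed.

Lemma law_pi_lambda (U V : T -> S) :
  measurable_fun setT U -> measurable_fun setT V ->
  (forall B, G B -> P (U @^-1` B) = P (V @^-1` B)) ->
  forall B, measurable B -> P (U @^-1` B) = P (V @^-1` B).
Proof.
move=> mU mV hG B; rewrite GE; move: B; apply: dynkin_induction => //.
- by move=> B mB hB; rewrite -!preimage_setC !probability_setC ?hB//; exact: mpre.
- move=> F mF tF hF; rewrite preimage_bigcup preimage_bigcup !measure_bigcup//.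
  + by apply: eq_eseriesr => i _; exact: hF.
  + by move=> i _; exact: mpre.
  + apply/trivIsetP => i j _ _ ij; rewrite -preimage_setI.
    by move/trivIsetP : tF => ->//; rewrite preimage_set0.
  + by move=> i _; exact: mpre.
  + apply/trivIsetP => i j _ _ ij; rewrite -preimage_setI.
    by move/trivIsetP : tF => ->//; rewrite preimage_set0.
Qed.

Local Notation pr := (Pr P).

(** The reference probability is taken at time 0, since all [V n] will share one law. *)
Definition mixing_with (E : set T) (V : nat -> T -> S) (B : set S) :=
  forall e : R, 0 < e -> exists N, forall n, (N <= n)%N ->
    `|pr (E `&` V n @^-1` B) - pr E * pr (V 0%N @^-1` B)| <= e.

(** The delicate closure is under increasing unions: equality of the laws makes the approximation of
    the union by one [F k] uniform in [n], so [k] can be chosen before [n]. *)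
Lemma mixing_pi_lambda (V : nat -> T -> S) (E : set T) :
  measurable E -> (forall n, measurable_fun setT (V n)) ->
  (forall n B, measurable B -> P (V n @^-1` B) = P (V 0%N @^-1` B)) ->
  (forall B, G B -> mixing_with E V B) ->
  forall B, measurable B -> mixing_with E V B.
Proof.
move=> mE mV lawV hG.
have mp n B : measurable B -> measurable (V n @^-1` B) by exact: mpre.
have mEp n B : measurable B -> measurable (E `&` V n @^-1` B).
  by move=> mB; apply: measurableI => //; exact: mp.
have lawV' n B : measurable B -> pr (V n @^-1` B) = pr (V 0%N @^-1` B).
  by move=> mB; rewrite /Pr lawV.
have pr_diff n (A B : set S) : measurable A -> measurable B -> B `<=` A ->
    pr (E `&` V n @^-1` (A `\` B)) =
      pr (E `&` V n @^-1` A) - pr (E `&` V n @^-1` B) /\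
    pr (V n @^-1` (A `\` B)) = pr (V 0%N @^-1` A) - pr (V 0%N @^-1` B).
  have -> : V n @^-1` (A `\` B) = V n @^-1` A `\` V n @^-1` B by [].
  move=> mA mB BA; split.
    rewrite setDE setIA -setDE prD; [|exact: mEp|exact: mp].
    by rewrite -setIA -preimage_setI (setIidr BA).
  rewrite prD; [|exact: mp|exact: mp].
  by rewrite -preimage_setI (setIidr BA) !lawV'.
move=> B mB; suff : <<s G >> `<=` [set B | measurable B /\ mixing_with E V B].
  by move=> /(_ B); rewrite -GE => /(_ mB)[].
apply: lambda_system_subset; [by []| | |by []]; last first.
  by move=> C GC; split; [rewrite GE; exact: sub_gen_smallest|exact: hG].
split => //.
- split=> // e e0; exists 0%N => n _.
  by rewrite !preimage_setT setIT prT mulr1 subrr normr0 ltW.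
- move=> C D DC [mC hC] [mD hD]; split; first exact: measurableD.
  move=> e e0; have e2 : 0 < e / 2 by rewrite divr_gt0.
  have [N1 h1] := hC _ e2; have [N2 h2] := hD _ e2.
  exists (maxn N1 N2) => n; rewrite geq_max => /andP[/h1 {}h1 /h2 {}h2].
  rewrite (pr_diff n C D mC mD DC).1 (pr_diff 0%N C D mC mD DC).2.
  move: h1 h2; rewrite !ler_norml => /andP[? ?] /andP[? ?]; nra.
- move=> F ndF hF.
  have mF i : measurable (F i) by case: (hF i).
  have mU : measurable (\bigcup_i F i) by exact: bigcup_measurable.
  split=> // e e0; have e2 : 0 < e / 2 by rewrite divr_gt0.
  have : P (V 0%N @^-1` F k) @[k --> \oo] --> P (V 0%N @^-1` (\bigcup_i F i)).
    rewrite preimage_bigcup; apply: nondecreasing_cvg_mu.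
    + by move=> k; exact: mp.
    + by rewrite -preimage_bigcup; exact: mp.
    + by move=> k l kl; apply/subsetPset; apply: preimage_subset; apply/subsetPset; exact: ndF.
  rewrite (prE P (mp _ _ mU)) => /fine_cvg/cvgrPdist_le/(_ _ e2)[k _ /(_ k (leqnn k))/= hk].
  have [N hN] := (hF k).2 _ e2; exists N => n /hN {}hN.
  have Fk : F k `<=` \bigcup_i F i by exact: bigcup_sup.
  have [h1 h2] := pr_diff n _ _ mU (mF k) Fk.
  have [_ h3] := pr_diff 0%N _ _ mU (mF k) Fk.
  (* Replacing the union by [F k] changes both terms of the correlation by amounts in [0, e/2]. They
     enter with opposite signs, so together they cost e/2 and not e. *)
  have h4 : pr (E `&` V n @^-1` (\bigcup_i F i `\` F k)) <=
            pr (V n @^-1` (\bigcup_i F i `\` F k)).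
    apply: pr_le; [exact/mEp/measurableD|exact/mp/measurableD|exact: subIsetr].
  have h5 := pr_ge0 P (E `&` V n @^-1` (\bigcup_i F i `\` F k)).
  have h6 := pr_ge0 P E.
  have h7 : pr E <= 1 by rewrite -(prT P); exact: pr_le.
  have {}hk : pr (V 0%N @^-1` (\bigcup_i F i)) - pr (V 0%N @^-1` F k) <= e / 2.
    exact: le_trans (ler_norm _) hk.
  move: hN h1 h2 h4 h5 h6 h7 hk; rewrite !ler_norml.
  move=> /andP[? ?] h1 h2 h4 h5 h6 h7 hk.
  by apply/andP; split; nra.
Qed.

End PiLambda.

Section Shift.
Context {dT : measure_display} {T : measurableType dT} {R : realType}.
Variable P : probability T R.
Context {I : choiceType} (X : I -> T -> R).
Hypothesis mX : forall i, measurable_fun setT (X i).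
Hypothesis iX : mutually_independent P X.
Hypothesis dX : identically_distributed P X.

Let mf (h : I -> I) :
  measurable_fun setT (fun w => (fun i => X (h i) w) : cylT I).
Proof. by apply: measurable_cyl => i; exact: mX. Qed.

Lemma shift_law (s t : I -> I) : cancel s t -> cancel t s ->
  forall A, cyl_sigma A ->
  P ((fun w i => X (s i) w) @^-1` A) = P ((fun w => X ^~ w) @^-1` A).
Proof.
move=> st ts; apply: (@law_pi_lambda _ _ _ P _ (cylT I) _
  (@cyl_sigma_rects R I) (@rects_setI R I) (fun w i => X (s i) w)
  (fun w i => X i w)) => // _ [J [B [mB ->]]].
rewrite -(rect_undup J).
have -> : (fun w i => X (s i) w) @^-1` rect (undup J) B =
    (fun w => X ^~ w) @^-1` rect (map s (undup J)) (B \o t).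
  apply/seteqP; split=> w /= wB i.
    by move=> /mapP[j /wB Bj ->]; rewrite /= st.
  by move=> iJ; have := wB (s i) (map_f s iJ); rewrite /= st.
rewrite !(rect_prob iX) ?undup_uniq ?(map_inj_uniq (can_inj st)) ?undup_uniq//; last first.
  by move=> i; exact: mB.
by rewrite big_map; apply: eq_bigr => i _; rewrite /= st; exact: dX.
Qed.

Lemma iter_can (A : Type) (s t : A -> A) n :
  cancel s t -> cancel (iter n s) (iter n t).
Proof. by move=> st; elim: n => [//|n IH] x; rewrite iterSr /= st IH. Qed.

(* Mixing at the level of finite rectangles extends to all cylinder events; applied to
   an invariant event A it says that A is independent of every event, hence of itself. *)
Lemma shift_ergodic (s t : I -> I) : cancel s t -> cancel t s ->
  (forall i j, exists N, forall n, (N <= n)%N -> iter n s i != j) ->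
  forall A : set (I -> R), cyl_sigma A -> (forall f, A (f \o s) <-> A f) ->
  P ((fun w => X ^~ w) @^-1` A) = 0%E \/ P ((fun w => X ^~ w) @^-1` A) = 1%E.
Proof.
move=> st ts wander A mA invA.
have [M hM] := choice (fun ij : I * I => wander ij.1 ij.2).
pose V n w := (fun i => X (iter n s i) w) : cylT I.
have lawV n B : cyl_sigma B -> P (V n @^-1` B) = P (V 0%N @^-1` B).
  move=> mB; rewrite (@shift_law (iter n s) (iter n t))//.
    exact: iter_can.
  exact: iter_can.
have invAn n f : A (f \o iter n s) <-> A f.
  elim: n f => [//|n IH] f; rewrite -(IH f) -[X in _ <-> X]invA.
  have -> // : f \o iter n.+1 s = (f \o iter n s) \o s.
  by apply/funext => i; rewrite /= -iterSr.
have VA n : V n @^-1` A = V 0%N @^-1` A.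
  by apply/seteqP; split=> w /=; rewrite -(invAn n (V 0%N w)).
have mV0 B : cyl_sigma B -> measurable (V 0%N @^-1` B).
  by move=> mB; apply: preimage_cyl => // i; exact: mX.
have mrect B : rects B -> @cyl_sigma R I B.
  by move=> rB; rewrite cyl_sigma_rects; exact: sub_gen_smallest.
have indA B : rects B ->
    P (V 0%N @^-1` A `&` V 0%N @^-1` B) = (P (V 0%N @^-1` A) * P (V 0%N @^-1` B))%E.
  move=> rB; have mB := mV0 _ (mrect _ rB).
  rewrite setIC muleC (prE P mB) (prE P (mV0 _ mA)) prE; last first.
    by apply: measurableI => //; exact: mV0.
  (* By invariance of [A] the correlation does not depend on [n]; being at most any [e] for large
     [n], it vanishes. *)
  rewrite -EFinM; congr EFin; apply/eqP; rewrite -subr_eq0 -normr_le0.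
  apply/ler_addgt0Pr => e e0; rewrite add0r.
  have [] := @mixing_pi_lambda _ _ _ P _ (cylT I) _ (@cyl_sigma_rects R I)
    (@rects_setI R I) V (V 0%N @^-1` B) mB _ _ _ A mA e e0.
  - by move=> n; exact: mf.
  - by move=> n C mC; exact: lawV.
  - move=> _ [K [C [mC ->]]] e' e'0.
    case: rB mB => J [D [mD ->]] mB.
    (* Beyond the largest wandering time over all pairs, the moved list is disjoint from [J], and
       the correlation is exactly zero. *)
    exists (\max_(i <- J) \max_(k <- K) M (k, i))%N => n hn.
    have [C' mC' hC] := rect_comp K (iter n s) mC.
    have E1 : V n @^-1` rect K C = (fun w => X ^~ w) @^-1` rect (map (iter n s) K) C'.
      by apply/seteqP; split=> w; [exact: (hC (X ^~ w)).1|exact: (hC (X ^~ w)).2].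
    have rK : cyl_sigma (rect K C) by apply: mrect; exists K, C.
    rewrite /Pr -(lawV n _ rK) E1 (rect_indep iX)//; last first.
      move=> i iJ; apply/mapP => -[k kK ik].
      have /hM : (M (k, i) <= n)%N.
        apply: leq_trans hn; apply: (@leq_trans (\max_(k <- K) M (k, i))%N).
          exact: (leq_bigmax_seq (F := fun k => M (k, i))).
        exact: (leq_bigmax_seq (F := fun i => \max_(k <- K) M (k, i))%N).
      by rewrite /= -ik eqxx.
    rewrite -E1 fineM; last 2 first.
    + by rewrite fin_num_measure.
    + by rewrite fin_num_measure//; apply: preimage_cyl => // i; exact: mX.
    by rewrite subrr normr0 ltW.
  - by move=> N /(_ N (leqnn N)); rewrite VA.
(* Independence of [A] from itself yields P(A) = P(A)^2. *)
have : P (V 0%N @^-1` A `&` V 0%N @^-1` A) =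
    (P (V 0%N @^-1` A) * P (V 0%N @^-1` A))%E.
  exact: (@indep_pi_lambda _ _ _ P _ (cylT I) _ (V 0%N) _
    (@cyl_sigma_rects R I) (@rects_setI R I) (mf _) (mV0 _ mA) indA).
rewrite setIid -[(fun w => X ^~ w)]/(V 0%N) (prE P (mV0 _ mA)) -EFinM => -[] /eqP.
rewrite -[X in X == _]mulr1 -subr_eq0 -mulrBr mulf_eq0 subr_eq0.
by move=> /orP[/eqP ->|/eqP <-]; [left|right].
Qed.

End Shift.

(** * Second moments *)

Section SecondMoment.
Context {dT : measure_display} {T : measurableType dT} {R : realType}.
Variable P : probability T R.

Definition sqint (X : T -> R) :=
  measurable_fun setT X /\ P.-integrable setT (fun w => (X w ^+ 2)%:E).

Lemma sqint_mul X Y : sqint X -> sqint Y ->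
  P.-integrable setT (fun w => (X w * Y w)%:E).
Proof.
move=> [mX iX] [mY iY].
apply: (le_integrable measurableT _ _ (integrableD measurableT iX iY)).
  by apply/measurable_EFinP; exact: measurable_funM.
move=> w _ /=; rewrite lee_fin [X in _ <= X]ger0_norm; last first.
  by rewrite addr_ge0 ?sqr_ge0.
rewrite ler_norml; have := sqr_ge0 (X w + Y w); have := sqr_ge0 (X w - Y w).
by move=> ? ?; apply/andP; split; nra.
Qed.

Lemma sqintZ c X : sqint X -> sqint (fun w => c * X w).
Proof.
move=> [mX iX]; split; first exact: measurable_funM.
under eq_fun do rewrite exprMn EFinM.
exact: integrableZl.
Qed.

Lemma sqintD X Y : sqint X -> sqint Y -> sqint (fun w => X w + Y w).
Proof.
move=> hX hY; split; first exact: measurable_funD hX.1 hY.1.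
have -> : (fun w => ((X w + Y w) ^+ 2)%:E) =
    (fun w => (X w ^+ 2)%:E + (2%:E * (X w * Y w)%:E + (Y w ^+ 2)%:E))%E.
  by apply/funext => w; rewrite -EFinM -!EFinD; congr EFin; ring.
apply: (integrableD measurableT hX.2); apply: (integrableD measurableT) hY.2.
by apply: integrableZl => //; exact: sqint_mul.
Qed.

Lemma sqint_sum (I : Type) (r : seq I) (X : I -> T -> R) :
  (forall i, sqint (X i)) -> sqint (fun w => \sum_(i <- r) X i w).
Proof.
move=> hX; elim: r => [|i r IH].
  split; first by under eq_fun do rewrite big_nil; exact: measurable_cst.
  under eq_fun do rewrite big_nil expr0n.
  exact: integrable0.
by under eq_fun do rewrite big_cons; exact: sqintD.
Qed.

Lemma Rintegral_sumM (I : Type) (r : seq I) (X : I -> T -> R) Y :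
  (forall i, sqint (X i)) -> sqint Y ->
  (\int[P]_w (Y w * \sum_(i <- r) X i w) =
   \sum_(i <- r) \int[P]_w (Y w * X i w))%R.
Proof.
move=> hX hY; elim: r => [|i r IH].
  rewrite big_nil; under eq_Rintegral do rewrite big_nil mulr0.
  by rewrite Rintegral_cst// mul0r.
rewrite big_cons -IH -RintegralD//; last 2 first.
- exact: sqint_mul.
- by apply: sqint_mul => //; exact: sqint_sum.
by apply: eq_Rintegral => w _; rewrite big_cons mulrDr.
Qed.

Lemma orthogonal_sum_sqr (I : eqType) (r : seq I) (X : I -> T -> R) : uniq r ->
  (forall i, sqint (X i)) ->
  (forall i j, i != j -> (\int[P]_w (X i w * X j w) = 0)%R) ->
  (\int[P]_w ((\sum_(i <- r) X i w) ^+ 2) = \sum_(i <- r) \int[P]_w (X i w ^+ 2))%R.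
Proof.
move=> + hX orth; elim: r => [_|i r IH /= /andP[ir ur]].
  rewrite big_nil; under eq_Rintegral do rewrite big_nil expr0n.
  by rewrite Rintegral_cst// mul0r.
rewrite big_cons -IH//.
have hS := sqint_sum r hX.
transitivity (\int[P]_w (X i w ^+ 2 +
   (2 * (X i w * \sum_(j <- r) X j w) + (\sum_(j <- r) X j w) ^+ 2)))%R.
  by apply: eq_Rintegral => w _; rewrite big_cons; ring.
have iXS : P.-integrable setT (EFin \o (fun w => 2 * (X i w * \sum_(j <- r) X j w))).
  rewrite (_ : _ \o _ = fun w => (2%:E * (X i w * \sum_(j <- r) X j w)%:E)%E).
    by apply: integrableZl => //; exact: sqint_mul.
  by apply/funext.
rewrite RintegralD//; last 2 first.
- exact: (hX i).2.
- by have := integrableD measurableT iXS hS.2; congr integrable; apply/funext.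
rewrite RintegralD//; last exact: hS.2.
rewrite RintegralZl//; last exact: sqint_mul.
rewrite Rintegral_sumM// big1_seq ?mulr0 ?add0r// => j /= jr.
by apply: orth; apply: contraNneq ir => ->.
Qed.

(** Independence makes the joint law of [X] and [Y] the product of the marginals, so Fubini applies;
    for fixed [y] the inner integral is [y] times the mean of [X]. *)
Lemma indep_mean0_mul (X Y : {RV P >-> R}) :
  (forall A B, measurable A -> measurable B ->
    P (X @^-1` A `&` Y @^-1` B) = (P (X @^-1` A) * P (Y @^-1` B))%E) ->
  P.-integrable setT (EFin \o X) -> (\int[P]_w (X w)%:E = 0)%E ->
  P.-integrable setT (fun w => (X w * Y w)%:E) ->
  (\int[P]_w (X w * Y w) = 0)%R.
Proof.
move=> ind iX EX iXY.
pose f (z : R * R) : \bar R := (z.1 * z.2)%:E.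
have mf : measurable_fun setT f.
  by apply/measurable_EFinP; apply: measurable_funM; [exact: measurable_fst|exact: measurable_snd].
have mXY : measurable_fun setT (fun w => (X w, Y w)) by exact: measurable_fun_pair.
pose m1 := distribution P X; pose m2 := distribution P Y.
pose Z : {mfun T >-> (R * R)%type} := mfun_Sub (mem_set mXY).
have mE A : measurable A -> (m1 \x m2)%E A = distribution P Z A.
  move: A; apply: product_measure_unique => A B mA mB.
  by rewrite /distribution /pushforward /= -ind.
have i12 : (m1 \x m2)%E.-integrable setT f.
  apply/integrableP; split => //.
  rewrite (eq_measure_integral (distribution P Z)); last by move=> A mA _; exact: mE.
  rewrite ge0_integral_distribution//; last exact: measurableT_comp.
  by have /integrableP[_ h] := iXY; exact: h.
have : (\int[m1 \x m2]_z f z = \int[P]_w (f (X w, Y w)))%E.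
  rewrite (eq_measure_integral (distribution P Z)); last by move=> A mA _; exact: mE.
  by rewrite integral_distribution.
rewrite /Rintegral => <-; rewrite -integral21_prod_meas1//.
rewrite (_ : fubini_G m1 f = fun=> 0%E) ?integral0//.
apply/funext => y; rewrite /fubini_G /f /=.
have mE' : measurable_fun setT (fun x : R => x%:E).
  by apply/measurable_EFinP; exact: measurable_id.
have ic : m1.-integrable setT (fun x : R => x%:E).
  exact: (@integrable_pushforward _ _ _ _ R X (measurable_funPT X) P setT _ mE' iX measurableT).
transitivity (\int[m1]_x (y%:E * x%:E))%E.
  by apply: eq_integral => x _; rewrite -EFinM mulrC.
rewrite (integralZl measurableT ic) integral_distribution//.
by rewrite EX mule0.
Qed.

Section Family.
Context {I : choiceType} (X : I -> T -> R).
Hypothesis mX : forall i, measurable_fun setT (X i).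
Hypothesis iX : mutually_independent P X.
Hypothesis dX : identically_distributed P X.
Hypothesis X1 : forall i, P.-integrable setT (EFin \o X i) /\ (\int[P]_w (X i w)%:E = 0)%E.
Hypothesis X2 : forall i, P.-integrable setT (fun w => (X i w ^+ 2)%:E).

Let sX i : sqint (X i). Proof. by split. Qed.

Lemma indep_orthogonal i j : i != j -> (\int[P]_w (X i w * X j w) = 0)%R.
Proof.
move=> ij; pose Xi : {RV P >-> R} := mfun_Sub (mem_set (mX i)).
pose Xj : {RV P >-> R} := mfun_Sub (mem_set (mX j)).
apply: (@indep_mean0_mul Xi Xj); [|exact: (X1 i).1|exact: (X1 i).2|exact: (sqint_mul (sX i) (sX j))].
move=> A B mA mB.
have := iX (J := [:: i; j]) (B := fun k => if k == i then A else B).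
rewrite /= inE ij => /(_ isT); rewrite !big_cons !big_nil setIT mule1 eqxx.
by rewrite [j == i]eq_sym (negPf ij); apply=> k; case: ifP.
Qed.

Lemma id_variance i j : (\int[P]_w (X i w ^+ 2) = \int[P]_w (X j w ^+ 2))%R.
Proof.
rewrite /Rintegral; congr fine.
have E k : (\int[P]_w (X k w ^+ 2)%:E = \int[pushforward P (X k)]_r (r ^+ 2)%:E)%E.
  rewrite ge0_integral_pushforward//.
    by apply/measurable_EFinP; exact: measurable_funX.
  by move=> r _; rewrite lee_fin sqr_ge0.
pose Xi : {RV P >-> R} := mfun_Sub (mem_set (mX i)).
pose Xj : {RV P >-> R} := mfun_Sub (mem_set (mX j)).
rewrite !E; apply: (@eq_measure_integral _ _ _ _ (distribution P Xj) (distribution P Xi)).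
by move=> A mA _; exact: dX.
Qed.

Lemma lincomb_sqint (J : Type) (r : seq J) (c : J -> R) (h : J -> I) :
  sqint (fun w => \sum_(j <- r) c j * X (h j) w).
Proof. by apply: sqint_sum => j; exact: sqintZ. Qed.

(** The common second moment of the family is represented by that of an arbitrary index [i0]. *)
Lemma lincomb_variance (J : eqType) (r : seq J) (c : J -> R) (h : J -> I) i0 :
  uniq r -> injective h ->
  (\int[P]_w ((\sum_(j <- r) c j * X (h j) w) ^+ 2) =
   \int[P]_w (X i0 w ^+ 2) * \sum_(j <- r) c j ^+ 2)%R.
Proof.
move=> ur hi; rewrite orthogonal_sum_sqr//.
- rewrite mulr_sumr; apply: eq_bigr => j _.
  rewrite (id_variance i0 (h j)) mulrC -RintegralZl//; last exact: X2.
  by apply: eq_Rintegral => w _; rewrite exprMn.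
- by move=> j; exact: sqintZ.
- move=> j k jk; transitivity (\int[P]_w (c j * c k * (X (h j) w * X (h k) w)))%R.
    by apply: eq_Rintegral => w _; ring.
  rewrite RintegralZl//; last exact: sqint_mul.
  by rewrite indep_orthogonal ?mulr0// (inj_eq hi).
Qed.

End Family.
End SecondMoment.

(** * Almost sure convergence of random series *)

(** Convergence through countable quantifiers only, which gives measurability of the convergence
    set. The factor 2 matches the threshold 2a of the maximal inequality. *)
Lemma cvgn_oscP (R : realType) (u : nat -> R) :
  cvgn u <-> forall l : nat, exists m, forall n,
    `|u (m + n)%N - u m| <= 2 * l.+1%:R^-1.
Proof.
split=> [/cvg_cauchy/cauchyP h l|h].
  have e0 : 0 < l.+1%:R^-1 :> R by rewrite invr_gt0.
  have [x [m _ hm]] := h _ e0; exists m => n.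
  have := hm (m + n)%N (leq_addr _ _); have := hm m (leqnn m).
  rewrite /ball /=; move: l.+1%:R^-1 => c h1 h2.
  have -> : u (m + n)%N - u m = (x - u m) - (x - u (m + n)%N) by ring.
  by have := ler_normB (x - u m) (x - u (m + n)%N); lra.
apply/cauchy_cvgP; apply: cauchy_exP => e e0.
have [l hl] : exists l : nat, 2 * l.+1%:R^-1 < e.
  exists (Num.truncn (2 / e)); rewrite ltr_pdivrMr// mulrC -ltr_pdivrMr//.
  exact: truncnS_gt.
have [m hm] := h l; exists (u m); exists m => // n /= mn.
rewrite /ball/= distrC -(subnKC mn).
by apply: le_lt_trans hl; exact: hm.
Qed.

Section RandomSeries.
Context {dT : measure_display} {T : measurableType dT} {R : realType}.
Variable P : probability T R.
Local Notation pr := (Pr P).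

Lemma measurable_norm_gt d (S : measurableType d) (f : S -> R) (c : R) :
  measurable_fun setT f -> measurable [set w | c < `|f w|].
Proof.
move=> mf.
have := measurableT_comp (@normr_measurable R setT) mf measurableT (measurable_itv `]c, +oo[).
by rewrite setTI; congr measurable; apply/seteqP; split=> w /=; rewrite in_itv/= andbT.
Qed.

Lemma chebyshev_sqint (X : T -> R) (a : R) : 0 < a -> sqint P X ->
  a ^+ 2 * pr [set w | a < `|X w|] <= (\int[P]_w (X w ^+ 2))%R.
Proof.
move=> a0 [mX iX]; pose X' : {RV P >-> R} := mfun_Sub (mem_set mX).
have mS : measurable [set w | a < `|X w|] by exact: measurable_norm_gt.
rewrite -lee_fin EFinM -(prE P mS) /Rintegral fineK; last exact: integrable_fin_num.
have := @markov _ _ _ P X' (fun r : R => r ^+ 2) a a0 (@exprn_measurable R setT 2).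
have h : {in Num.nneg &, {homo (fun r : R => r ^+ 2) : x y / x <= y}}.
  by move=> x y; rewrite !nnegrE => x0 y0 xy; rewrite ler_sqr.
move=> /(_ (fun r _ => sqr_ge0 r) h).
rewrite unlock.
rewrite (_ : (\int[P]_w _)%E = (\int[P]_w (X w ^+ 2)%:E)%E); last first.
  by apply: eq_integral => w _; rewrite /= real_normK ?num_real.
apply: le_trans; apply: lee_pmul => //; first by rewrite lee_fin sqr_ge0.
apply: le_measure; rewrite ?inE//; last by move=> w /= /ltW; rewrite lee_fin.
rewrite (_ : mkset _ = (Num.norm \o X) @^-1` `[a, +oo[%classic).
  rewrite -[X in measurable X]setTI.
  exact: (measurableT_comp (@normr_measurable R setT) mX measurableT (measurable_itv `[a, +oo[)).
by apply/seteqP; split=> w /=; rewrite in_itv/= andbT lee_fin.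
Qed.

Lemma prU_disj (A B : set T) : measurable A -> measurable B -> A `&` B = set0 ->
  pr (A `|` B) = pr A + pr B.
Proof.
by move=> mA mB AB; rewrite /Pr measureU// fineD// fin_num_measure.
Qed.

Lemma prU_le (A B : set T) : measurable A -> measurable B ->
  pr (A `|` B) <= pr A + pr B.
Proof.
move=> mA mB; rewrite -lee_fin EFinD -!prE//; last exact: measurableU.
exact: measureU2.
Qed.

(** * Ottaviani's maximal inequality *)

Section Ottaviani.
Variable Y : nat -> T -> R.
Hypothesis mY : forall k, measurable_fun setT (Y k).
(** The index [minn i k] lets a field over all of [nat] carry exactly the finite past [Y 0], ...,
    [Y k]. *)
Hypothesis indY : forall k, indep_fields P
  (fun w i => Y (minn i k) w) (fun w j => Y (k.+1 + j)%N w).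

Definition psum n w := \sum_(k < n) Y k w.

Lemma psum_tail N k w : (k <= N)%N ->
  psum N w - psum k w = \sum_(i < N - k) Y (k + i)%N w.
Proof.
move=> kN; have -> : psum N w = psum (k + (N - k)) w by rewrite subnKC.
by rewrite /psum big_split_ord/= addrAC subrr add0r.
Qed.

Lemma psum_measurable n : measurable_fun setT (psum n).
Proof. by apply: measurable_sum => k; exact: mY. Qed.

Let exceed (a : R) M := [set w | exists2 j, (j < M)%N & 2 * a < `|psum j w|].

Let exceed_measurable (a : R) M : measurable (exceed a M).
Proof.
apply: bigcup_measurable => j _; apply: measurable_norm_gt.
exact: psum_measurable.
Qed.

Let cylsum (n : nat) : measurable_fun setT (fun y : cylT (R := R) nat => \sum_(i < n) y i).
Proof. by apply: measurable_sum => i; exact: cyl_eval. Qed.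

(** Despite the name, this is the event that the sums at [N] and [k] differ by more than [a]; its
    complement is the favourable one. *)
Let close (a : R) N k := [set w | a < `|psum N w - psum k w|].

Let close_measurable (a : R) N k : measurable (close a N k).
Proof.
apply: measurable_norm_gt; apply: measurable_funB; exact: psum_measurable.
Qed.

(** A first exceedance at time [k.+1] is decided by [Y 0], ..., [Y k], while the remaining increment
    uses only later terms. Time 0 is left out because the empty sum never exceeds 2a. *)
Let first_exceed_indep (a : R) N k : (k < N)%N ->
  pr (([set w | 2 * a < `|psum k.+1 w|] `\` exceed a k.+1) `\` close a N k.+1) =
  pr ([set w | 2 * a < `|psum k.+1 w|] `\` exceed a k.+1) * (1 - pr (close a N k.+1)).
Proof.
move=> kN.
pose B : set (nat -> R) := [set y : nat -> R | 2 * a < `|\sum_(i < k.+1) y i|] `\`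
  [set y : nat -> R | exists2 j, (j < k.+1)%N & 2 * a < `|\sum_(i < j) y i|].
pose C : set (nat -> R) := [set y : nat -> R | a < `|\sum_(i < N - k.+1) y i|].
have mB : cyl_sigma B.
  apply: (@measurableD _ (cylT nat)).
    exact: (measurable_norm_gt _ (cylsum k.+1)).
  apply: (@bigcup_measurable _ (cylT nat)) => j _.
  exact: (measurable_norm_gt _ (cylsum j)).
have mC : cyl_sigma C by exact: (measurable_norm_gt _ (cylsum _)).
have psE w j : (j <= k.+1)%N -> \sum_(i < j) Y (minn i k) w = psum j w.
  move=> jk; apply: eq_bigr => i _; congr (Y _ w).
  by apply/minn_idPl; rewrite -ltnS; exact: leq_trans (ltn_ord i) jk.
have BE : [set w | 2 * a < `|psum k.+1 w|] `\` exceed a k.+1 =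
    (fun w i => Y (minn i k) w) @^-1` B.
  apply/seteqP; split=> w [/= h1 h2]; split; rewrite /= ?psE// in h1 *.
    by move=> [j jk]; rewrite psE 1?ltnW// => hj; apply: h2; exists j.
  by move=> [j jk hj]; apply: h2; exists j => //; rewrite psE 1?ltnW.
have CE : close a N k.+1 = (fun w j => Y (k.+1 + j)%N w) @^-1` C.
  by apply/seteqP; split=> w; rewrite /close /C /= psum_tail.
rewrite prD; [|exact: measurableD (measurable_norm_gt _ (psum_measurable _)) (exceed_measurable _ _)|exact: close_measurable].
by rewrite mulrBr mulr1 BE CE /Pr indY// fineM// fin_num_measure// -?BE -?CE;
  [exact: measurableD (measurable_norm_gt _ (psum_measurable _)) (exceed_measurable _ _)|exact: close_measurable].
Qed.

(* Decompose according to the first time k at which |S_k| exceeds 2a: that event is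
   independent of S_N - S_k, which is at most a with probability at least 1/2. *)
Lemma ottaviani (a : R) N : 0 < a ->
  (forall k, (k <= N)%N -> pr [set w | a < `|psum N w - psum k w|] <= 1 / 2) ->
  pr [set w | exists2 j, (j < N.+1)%N & 2 * a < `|psum j w|] <=
  2 * pr [set w | a < `|psum N w|].
Proof.
move=> a0 hclose.
pose first j := [set w | 2 * a < `|psum j w|] `\` exceed a j.
pose E M := [set w | exists2 j, (j < M)%N & (first j `\` close a N j) w].
have mgt j : measurable [set w | 2 * a < `|psum j w|].
  exact: measurable_norm_gt (psum_measurable j).
have mfirst j : measurable (first j) by exact: measurableD.
have mD j : measurable (first j `\` close a N j) by exact: measurableD.
have mE M : measurable (E M) by apply: bigcup_measurable => j _.
(* By induction on [M]: each new first-exceedance event retains at least half of its mass when the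
   late increment is required to be at most [a]. *)
have key M : (M <= N.+1)%N -> pr (exceed a M) <= 2 * pr (E M).
  elim: M => [_|M IH MN].
    rewrite (_ : exceed a 0 = set0) ?/Pr ?measure0 ?mulr_ge0 ?pr_ge0//.
    by apply/seteqP; split=> w // -[].
  have -> : exceed a M.+1 = exceed a M `|` first M.
    apply/seteqP; split=> w.
      move=> [j]; rewrite ltnS leq_eqVlt => /orP[/eqP -> hM|jM hj].
        by have [h|h] := pselect (exceed a M w); [left|right].
      by left; exists j.
    move=> [[j jM hj]|[hM _]]; first by exists j => //; exact: ltnW.
    by exists M.
  have -> : E M.+1 = E M `|` (first M `\` close a N M).
    apply/seteqP; split=> w.
      move=> [j]; rewrite ltnS leq_eqVlt => /orP[/eqP -> hM|jM hj]; first by right.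
      by left; exists j.
    move=> [[j jM hj]|hM]; first by exists j => //; exact: ltnW.
    by exists M.
  rewrite (prU_disj (mE M) (mD M)); last first.
    rewrite -subset0 => w [[j jM hj] hM]; case: hj => hj _; case: hj => h1 _.
    by case: hM => hM _; case: hM => _ h2; apply: h2; exists j.
  apply: le_trans (prU_le (exceed_measurable a M) (mfirst M)) _.
  rewrite mulrDr lerD// ?IH 1?ltnW//.
  case: M {IH} MN => [_|k kN].
    rewrite (_ : first 0%N = set0) ?/Pr ?measure0 ?mulr_ge0 ?pr_ge0//.
    apply/seteqP; split=> w // -[]; rewrite /= /psum big_ord0 normr0 => h _.
    by lra.
  rewrite first_exceed_indep//; have := hclose k.+1 kN.
  by have := pr_ge0 P (first k.+1); rewrite -/(first k.+1) /close; nra.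
apply: le_trans (key _ (leqnn _)) _; rewrite ler_pM2l//; apply: pr_le => //.
  exact: measurable_norm_gt (psum_measurable N).
(* If the sum at [j] exceeds 2a and the late increment is at most [a], the sum at [N] exceeds
   [a]. *)
move=> w [j jN hj]; case: hj => hj /negP; case: hj => /= h1 _; rewrite -leNgt => h2.
have := ler_normB (psum N w) (psum N w - psum j w).
by rewrite opprB addrC subrK => h3; lra.
Qed.

End Ottaviani.

Lemma pr_bigcup_le (F : (set T)^nat) (c : R) : (forall n, measurable (F n)) ->
  nondecreasing_seq F -> (forall n, pr (F n) <= c) -> pr (\bigcup_n F n) <= c.
Proof.
move=> mF ndF hF.
have mU : measurable (\bigcup_n F n) by exact: bigcup_measurable.
have : P (F n) @[n --> \oo] --> P (\bigcup_n F n) by exact: nondecreasing_cvg_mu.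
rewrite (prE P mU) => /fine_cvg/cvgrPdist_le h.
apply/ler_addgt0Pr => e e0; have [k _ /(_ k (leqnn k))/= hk] := h e e0.
have := hF k; have := le_trans (ler_norm _) hk; rewrite /Pr; lra.
Qed.

Lemma bounded_sum_tail (b : nat -> R) (C : R) : (forall k, 0 <= b k) ->
  (forall n, \sum_(k < n) b k <= C) ->
  forall e, 0 < e -> exists m, forall n, \sum_(k < n) b (m + k)%N <= e.
Proof.
move=> b0 hC e e0; pose u n := \sum_(k < n) b k.
have hs : has_sup (range u).
  by split; [exists (u 0%N), 0%N|exists C => _ [n _ <-]; exact: hC].
have [_ [m _ <-] hm] := sup_adherent e0 hs.
exists m => n; have : u (m + n)%N <= sup (range u).
  by apply: sup_upper_bound => //; exists (m + n)%N.
by rewrite /u big_split_ord/= -/(u m) => ?; lra.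
Qed.

(** * Almost sure convergence from summable variances *)

Section AlmostSure.
Variable Y : nat -> T -> R.
Hypothesis mY : forall k, measurable_fun setT (Y k).
Hypothesis indY : forall m k, indep_fields P
  (fun w i => Y (m + minn i k)%N w) (fun w j => Y (m + (k.+1 + j))%N w).
Variables (b : nat -> R) (C : R).
Hypothesis b0 : forall k, 0 <= b k.
Hypothesis bC : forall n, \sum_(k < n) b k <= C.
Hypothesis sqY : forall m n, sqint P (fun w => \sum_(k < n) Y (m + k)%N w).
Hypothesis varY : forall m n,
  (\int[P]_w ((\sum_(k < n) Y (m + k)%N w) ^+ 2) <= \sum_(k < n) b (m + k)%N)%R.

Let osc (a : R) m := [set w | exists n, 2 * a < `|psum (fun k => Y (m + k)%N) n w|].

(** The maximal inequality for the series restarted at [m]. The bound on [e] is what makes Chebyshev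
    give probability at most 1/2 to every late increment; Chebyshev for the whole block then gives
    2e / a^2. *)
Let osc_small (a : R) m (e : R) : 0 < a -> e <= a ^+ 2 / 2 ->
  (forall n, \sum_(k < n) b (m + k)%N <= e) -> a ^+ 2 * pr (osc a m) <= 2 * e.
Proof.
move=> a0 ea hb; set Z := fun k => Y (m + k)%N.
have a2 : 0 < a ^+ 2 by exact: exprn_gt0.
have cheb l n : a ^+ 2 * pr [set w | a < `|\sum_(k < n) Y (m + (l + k))%N w|] <= e.
  under eq_set do under eq_bigr do rewrite addnA.
  apply: le_trans (chebyshev_sqint a0 (sqY (m + l) n)) _.
  apply: le_trans (varY (m + l) n) _; apply: le_trans (hb (l + n)%N).
  rewrite big_split_ord/= -[X in X <= _]add0r lerD ?sumr_ge0//.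
  by under eq_bigr do rewrite -addnA.
rewrite -ler_pdivlMl//.
have -> : osc a m = \bigcup_N [set w | exists2 j, (j < N)%N & 2 * a < `|psum Z j w|].
  apply/seteqP; split=> w; first by move=> [n hn]; exists n.+1 => //; exists n.
  by move=> [N _ [j _ hj]]; exists j.
apply: pr_bigcup_le.
- move=> N; apply: bigcup_measurable => j _; apply: measurable_norm_gt.
  by apply: psum_measurable => k; exact: mY.
- by move=> M N MN; apply/subsetPset => w [j jM hj]; exists j => //; exact: leq_trans jM MN.
- case=> [|N].
    rewrite (_ : mkset _ = set0) ?/Pr ?measure0/=; last by apply/seteqP; split=> w // -[].
    have e0 : 0 <= e by apply: le_trans (hb 0%N); rewrite big_ord0.
    by rewrite mulr_ge0 ?invr_ge0 ?mulr_ge0// ltW.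
  rewrite ler_pdivlMl//.
  apply: le_trans (ler_wpM2l (ltW a2) (ottaviani _ _ a0 _)) _.
  + by move=> k; exact: mY.
  + by move=> k; exact: indY.
  + move=> k kN; have := cheb k (N - k)%N.
    under eq_set do rewrite -(psum_tail Z)//.
    by move=> h; rewrite -(ler_pM2l a2); lra.
  + by have := cheb 0%N N; rewrite /psum /Z; under eq_set do under eq_bigr do rewrite add0n; lra.
Qed.

Lemma as_cvg_series :
  {ae P, forall w, cvgn (fun n => \sum_(k < n) Y k w)}.
Proof.
have mosc a m : measurable (osc a m).
  rewrite (_ : osc a m = \bigcup_n [set w | 2 * a < `|psum (fun k => Y (m + k)%N) n w|]).
    apply: bigcup_measurable => n _; apply: measurable_norm_gt.
    by apply: psum_measurable => k; exact: mY.
  by apply/seteqP; split=> w; [move=> [n hn]; exists n|move=> [n _ hn]; exists n].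
pose bad a := \bigcap_m osc a m.
have mbad a : measurable (bad a) by exact: bigcap_measurable.
have bad0 a : 0 < a -> P (bad a) = 0%E.
  move=> a0; rewrite prE//; congr EFin; apply/eqP; rewrite eq_le pr_ge0 andbT.
  have a2 : 0 < a ^+ 2 by exact: exprn_gt0.
  apply/ler_addgt0Pr => e e0; rewrite add0r.
  (* The first bound is the one required by [osc_small]; the second turns its conclusion into a
     probability at most [e]. *)
  pose d := Num.min (a ^+ 2 / 2) (a ^+ 2 * e / 2).
  have d0 : 0 < d by rewrite lt_min !divr_gt0// mulr_gt0.
  have [m hm] := bounded_sum_tail b0 bC d0.
  have d1 : d <= a ^+ 2 / 2 by rewrite ge_min lexx.
  have d2 : d <= a ^+ 2 * e / 2 by rewrite ge_min lexx orbT.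
  apply: (@le_trans _ _ (pr (osc a m))).
    by apply: pr_le => //; exact: bigcap_inf.
  rewrite -(ler_pM2l a2); have := osc_small a0 d1 hm; lra.
have badN : P.-negligible (\bigcup_l bad l.+1%:R^-1).
  by apply: negligible_bigcup => l; apply/negligibleP => //; exact: bad0.
apply: (negligibleS _ badN).
move=> w; apply: contra_notP => nbad; apply/cvgn_oscP => l.
have : ~ bad l.+1%:R^-1 w by move=> h; apply: nbad; exists l.
move/existsNP => [m /not_implyP[_ /forallNP h]]; exists m => n.
rewrite -[X in X - _]/(psum Y _ w) -/(psum Y m w) psum_tail ?leq_addr// addKn.
by rewrite leNgt; apply/negP; exact: h.
Qed.

End AlmostSure.
End RandomSeries.

(** * Limits in L^2 *)

Section LimMeasurable.
Context {R : realType} {d : measure_display} {S : measurableType d}.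
Variable u : nat -> S -> R.
Hypothesis mu : forall n, measurable_fun setT (u n).

Lemma measurable_cvgn : measurable [set w | cvgn (fun n => u n w)].
Proof.
rewrite (_ : mkset _ = \bigcap_l \bigcup_m \bigcap_n
   ~` [set w | 2 * l.+1%:R^-1 < `|u (m + n)%N w - u m w|]).
  apply: bigcap_measurable => // l _; apply: bigcup_measurable => m _.
  apply: bigcap_measurable => // n _; apply: measurableC.
  by apply: measurable_norm_gt; exact: measurable_funB.
apply/seteqP; split=> w.
  move=> /cvgn_oscP h l _; have [m hm] := h l; exists m => // n _ /=.
  by apply/negP; rewrite -leNgt; exact: hm.
move=> h; apply/cvgn_oscP => l; have [m _ hm] := h l I; exists m => n.
by rewrite leNgt; apply/negP; exact: hm.
Qed.

(* lim is a fixed junk value where the sequence diverges. *)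
Lemma measurable_limn : measurable_fun setT (fun w => limn (fun n => u n w)).
Proof.
pose C := [set w | cvgn (fun n => u n w)].
pose c : R := point.
(* Patched with the default value off the convergence set, the sequence converges everywhere, and to
   the same [limn]. *)
pose v n w : R := u n w * \1_C w + c * \1_(~` C) w.
apply: (@measurable_fun_cvg _ _ _ _ v).
  have mC := measurable_cvgn.
  move=> n; apply: measurable_funD; apply: measurable_funM => //.
  by apply: measurable_indic; exact: measurableC.
move=> w _; rewrite /v; have [Cw|nCw] := pselect (C w).
  rewrite !indicE (mem_set Cw) (memNset (fun nC : (~` C) w => nC Cw)).
  by under eq_cvg do rewrite mulr1 mulr0 addr0.
rewrite dvgP// !indicE (memNset nCw) (mem_set (nCw : (~` C) w)).
under eq_cvg do rewrite mulr0 mulr1 add0r.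
exact: cvg_cst.
Qed.

End LimMeasurable.

Section L2Series.
Context {dT : measure_display} {T : measurableType dT} {R : realType}.
Variable P : probability T R.
Variable Y : nat -> T -> R.
Hypothesis mY : forall k, measurable_fun setT (Y k).
Variables (b : nat -> R) (C : R).
Hypothesis b0 : forall k, 0 <= b k.
Hypothesis bC : forall n, \sum_(k < n) b k <= C.
Hypothesis sqY : forall m n, sqint P (fun w => \sum_(k < n) Y (m + k)%N w).
Hypothesis varY : forall m n,
  (\int[P]_w ((\sum_(k < n) Y (m + k)%N w) ^+ 2) <= \sum_(k < n) b (m + k)%N)%R.
Hypothesis cvgY : {ae P, forall w, cvgn (fun n => \sum_(k < n) Y k w)}.

Let S n w := \sum_(k < n) Y k w.
Let D w := limn (fun n => S n w).

Let mS n : measurable_fun setT (S n).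
Proof. exact: psum_measurable. Qed.

Let mD : measurable_fun setT D.
Proof. exact: measurable_limn. Qed.

(** Fatou is applied in [n], with [m] fixed, to the squared increments from [m] to [m + n]: their
    integrals are at most [e], and their lower limit is the squared remainder wherever the series
    converges. *)
Let l2_tail m (e : R) : (forall n, \sum_(k < n) b (m + k)%N <= e) ->
  (\int[P]_w ((S m w - D w) ^+ 2)%:E <= e%:E)%E.
Proof.
move=> hb; pose f n w := ((S m w - S (m + n)%N w) ^+ 2)%:E.
have mf n : measurable_fun setT (f n).
  by apply/measurable_EFinP; apply: measurable_funX; exact: measurable_funB.
have f0 n w : (0 <= f n w)%E by rewrite lee_fin sqr_ge0.
have hf n : (\int[P]_w f n w <= e%:E)%E.
  have fE w : f n w = ((\sum_(k < n) Y (m + k)%N w) ^+ 2)%:E.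
    by rewrite /f -opprB sqrrN /S big_split_ord/= addrAC subrr add0r.
  under eq_integral do rewrite fE.
  rewrite -[X in (X <= _)%E]fineK; last first.
    exact: integrable_fin_num (sqY m n).2.
  by rewrite lee_fin; apply: le_trans (hb n); exact: varY.
have mlim : measurable_fun setT (fun w => limn_einf (f ^~ w)).
  rewrite (_ : (fun w => _) = (fun w => - limn_esup (fun n => - f n w))%E).
    apply: measurableT_comp => //; apply: measurable_fun_limn_esup => n.
    exact: measurableT_comp.
  by apply/funext => w; rewrite -[LHS]oppeK -limn_esupN.
rewrite (_ : (\int[P]_w _)%E = (\int[P]_w limn_einf (f ^~ w))%E); last first.
  apply: ge0_ae_eq_integral => //.
  - by apply/measurable_EFinP; apply: measurable_funX; exact: measurable_funB.
  - by move=> w _; rewrite lee_fin sqr_ge0.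
  - move=> w _; rewrite limn_einf_lim; apply: lime_ge; first exact: is_cvg_einfs.
    by near=> n; apply/ereal_infP => _ [k _ <-].
  apply: filterS cvgY => w cw _.
  have : f ^~ w n @[n --> \oo] --> ((S m w - D w) ^+ 2)%:E.
    apply: cvg_EFin; first by near=> n.
    rewrite /comp /= ; apply: (@cvg_comp _ _ _ (fun n => S m w - S (m + n)%N w) (fun x : R => x ^+ 2)); last first.
      exact: exprn_continuous.
    apply: cvgB; first exact: cvg_cst.
    rewrite (_ : (fun n => S (m + n)%N w) = (fun n => S (n + m)%N w)); last first.
      by apply/funext => n; rewrite addnC.
    by rewrite (cvg_shiftn m (S ^~ w)); exact: cw.
  by move=> /cvg_limn_einf_sup[-> _].
apply: le_trans (fatou P measurableT mf (fun n w _ => f0 n w)) _.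
rewrite limn_einf_lim; apply: lime_le; first exact: is_cvg_einfs.
near=> n; apply: ge_ereal_inf; exists (\int[P]_w f n w)%E => //.
by exists n => /=.
Unshelve. all: by end_near.
Qed.

Lemma l2_cvg_series :
  (fun n => (\int[P]_w ((S n w - D w) ^+ 2)%:E)%E) @ \oo --> 0%E.
Proof.
have tail e : 0 < e -> exists m, forall n, (m <= n)%N ->
    (\int[P]_w ((S n w - D w) ^+ 2)%:E <= e%:E)%E.
  move=> e0; have [m hm] := bounded_sum_tail b0 bC e0; exists m => n mn.
  apply: l2_tail => k; apply: le_trans (hm (n - m + k)%N).
  rewrite big_split_ord/= -[X in X <= _]add0r lerD ?sumr_ge0//.
  by apply: ler_sum => i _; rewrite addnA subnKC.
have I0 n : (0 <= \int[P]_w ((S n w - D w) ^+ 2)%:E)%E.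
  by apply: integral_ge0 => w _; rewrite lee_fin sqr_ge0.
apply/fine_cvgP; split.
  have [m hm] := tail 1 ltr01; exists m => // n /= mn.
  by rewrite ge0_fin_numE//; apply: le_lt_trans (hm n mn) _; rewrite ltry.
apply/cvgrPdist_le => e e0; have [m hm] := tail e e0; exists m => // n /= mn.
rewrite sub0r normrN ger0_norm ?fine_ge0//.
rewrite -lee_fin fineK ?hm// ge0_fin_numE//.
by apply: le_lt_trans (hm n mn) _; rewrite ltry.
Qed.

End L2Series.

(** * The field Delta *)

Lemma ae_forall_count d (T : measurableType d) (R : realType) (P : probability T R)
    (I : countType) (Q : I -> T -> Prop) :
  (forall i, {ae P, forall w, Q i w}) -> {ae P, forall w, forall i, Q i w}.
Proof.
move=> hQ.
have h n : {ae P, forall w, if choice.unpickle n is Some i then Q i w else True}.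
  by case: (choice.unpickle n) => [i|]; [exact: hQ|exact: aeW].
apply: filterS (ae_foralln h) => w hw i.
by have := hw (choice.pickle i); rewrite choice.pickleK.
Qed.

Lemma cyl_map (R : realType) (I J : Type) (f : (I -> R) -> J -> R) :
  (forall j, measurable_fun setT (fun y : cylT (R := R) I => f y j)) ->
  forall A, cyl_sigma A -> cyl_sigma (f @^-1` A).
Proof. by move=> mf A mA; exact: (@preimage_cyl R _ (cylT I) J f). Qed.

Section DeltaAlgebra.
Context {R : realType} {dim : nat} (p : Zd dim -> R).
Hypothesis hp : good_kernel p.

Definition dcoef k x y (z : Zd dim) : R := pk p k y z - pk p k x z.

Definition dsupp k x y : seq (Zd dim) := fset_set (dcoef k x y @^-1` [set~ 0]).

(** Layer [k] reads the noise of time [t - k] only, so distinct layers use disjoint families of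
    noise variables. *)
Definition layer (dT : measure_display) (T : measurableType dT)
    (xi : int -> Zd dim -> T -> R) (t : int) (x y : Zd dim) (k : nat) (w : T) : R :=
  \sum_(z \in [set: Zd dim]) xi (t - k%:Z) z w * (pk p k y z - pk p k x z).

Section Noise.
Context (dT : measure_display) (T : measurableType dT) (xi : int -> Zd dim -> T -> R).

Lemma layerE t x y k w :
  layer xi t x y k w = \sum_(z <- dsupp k x y) dcoef k x y z * xi (t - k%:Z) z w.
Proof.
rewrite /layer (fsum_fset (pk_diff_fsupp hp k x y)).
  by apply: eq_bigr => z _; rewrite mulrC.
by move=> z /= /contrapT ->; rewrite mulr0.
Qed.

Lemma layer_fsupp t x y k w :
  fsupp (fun z => xi (t - k%:Z) z w * (pk p k y z - pk p k x z)).
Proof. by apply: fsuppMl; exact: pk_diff_fsupp. Qed.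

Lemma dsupp_energy k x y :
  \sum_(z <- dsupp k x y) dcoef k x y z ^+ 2 = pk_energy p k x y.
Proof.
rewrite /pk_energy (fsum_fset (pk_diff_fsupp hp k x y))//.
by move=> z /= /contrapT ->; rewrite expr0n.
Qed.

Lemma Delta_partial_add t x y z n w :
  Delta_partial p xi t x y n w + Delta_partial p xi t y z n w =
  Delta_partial p xi t x z n w.
Proof.
rewrite /Delta_partial -big_split/=; apply: eq_bigr => k _.
rewrite -fsumD; [|exact: layer_fsupp..].
by apply: eq_fsbigr => v _; ring.
Qed.

(** Exact before any limit, at the price of one extra layer on the left: layer 0 is the new noise,
    and layer [k + 1] at time [t + 1] reads the same noise as layer [k] at time [t], so a first-step
    decomposition of p^(k+1) matches them. *)
Lemma Delta_partial_evolution t x y n w :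
  Delta_partial p xi (t + 1) x y n.+1 w =
  \sum_(v <- ksupp p) p v * Delta_partial p xi t (x + v) (y + v) n w
  + xi (t + 1) y w - xi (t + 1) x w.
Proof.
rewrite /Delta_partial big_ord_recl /= subr0.
have point_sum a : \sum_(z \in [set: Zd dim]) xi (t + 1) z w * (a == z)%:R = xi (t + 1) a w.
  rewrite (fsum_fset (finite_set1 a)); last first.
    by move=> z /eqP; rewrite /= eq_sym => /negPf ->; rewrite mulr0.
  by rewrite fset_set1 big_seq_fset1 eqxx mulr1.
have -> : \sum_(z \in [set: Zd dim]) xi (t + 1) z w * ((y == z)%:R - (x == z)%:R) =
    xi (t + 1) y w - xi (t + 1) x w.
  rewrite -!point_sum -fsumB; last 2 first.
  - by apply: fsuppMl; exact: (pk_fsupp hp 0 y).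
  - by apply: fsuppMl; exact: (pk_fsupp hp 0 x).
  by apply: eq_fsbigr => z _; rewrite mulrBr.
rewrite addrC addrA; congr (_ + _ - _).
under [RHS]eq_bigr do rewrite mulr_sumr.
rewrite exchange_big/=; apply: eq_bigr => k _.
rewrite (_ : t + 1 - (bump 0 k)%:Z = t - k%:Z); last by rewrite /bump/=; lia.
under [RHS]eq_bigr do rewrite mulr_fsumr.
rewrite -fsum_sum; last by move=> v; apply: fsuppMl; exact: layer_fsupp.
apply: eq_fsbigr => z _.
rewrite -![\sum_(_ \in _) _]/(pk p k.+1 _ _) !(pkS hp) -sumrB mulr_sumr.
by apply: eq_bigr => v _; ring.
Qed.

Hypothesis mxi : forall t x, measurable_fun setT (xi t x).

Lemma layer_measurable t x y k : measurable_fun setT (layer xi t x y k).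
Proof.
rewrite (_ : layer _ _ _ _ _ =
    fun w => \sum_(z <- dsupp k x y) dcoef k x y z * xi (t - k%:Z) z w); last first.
  by apply/funext => w; exact: layerE.
by apply: measurable_sum => z; exact: measurable_funM.
Qed.

Lemma Delta_measurable t x y : measurable_fun setT (Delta p xi t x y).
Proof.
apply: measurable_limn => n.
by apply: measurable_sum => k; exact: layer_measurable.
Qed.

End Noise.

(** Allows noises on different probability spaces to be compared; since only times up to [t] enter,
    it also shows Delta to be a function of the past. *)
Lemma eq_Delta (d1 d2 : measure_display) (T1 : measurableType d1) (T2 : measurableType d2)
    (xi1 : int -> Zd dim -> T1 -> R) (xi2 : int -> Zd dim -> T2 -> R) t x y w1 w2 :
  (forall (k : nat) z, xi1 (t - k%:Z) z w1 = xi2 (t - k%:Z) z w2) ->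
  Delta p xi1 t x y w1 = Delta p xi2 t x y w2.
Proof.
move=> h; rewrite /Delta; congr (limn _); apply/funext => n.
apply: eq_bigr => k _; apply: eq_fsbigr => z _; by rewrite h.
Qed.

Definition coord (t : int) (x : Zd dim) (f : cylT (R := R) (int * Zd dim)%type) : R :=
  f (t, x).

(* Delta on the canonical space of noise configurations: Delta_field p xi w and
   Phi (fun j => xi j.1 j.2 w) are convertible. *)
Definition Phi (f : cylT (R := R) (int * Zd dim)%type) := Delta_field p coord f.

Definition st_move (x : Zd dim) (t : int) (j : int * Zd dim) : int * Zd dim :=
  (j.1 + t, j.2 + x).

(** Partial sums agree term by term after translating the summation site, by translation invariance
    of p^k. The limits then agree at every configuration, default values included. *)
Lemma Phi_shift x t f : Phi (f \o st_move x t) = st_shift x t (Phi f).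
Proof.
apply/funext => -[[s y] i]; rewrite /Phi /st_shift /Delta_field /= /Delta.
congr (limn _); apply/funext => n; apply: eq_bigr => k _ /=.
rewrite [RHS](reindex_fsbigT _ _ (shift_bij x)).
apply: eq_fsbigr => z _; rewrite /coord /st_move /=.
by rewrite addrAC (addrAC y x) !(pk_shift hp).
Qed.

Lemma Phi_cyl A : cyl_sigma A -> cyl_sigma (Phi @^-1` A).
Proof.
apply: cyl_map => -[[t x] i]; apply: Delta_measurable => s y.
exact: cyl_eval.
Qed.

End DeltaAlgebra.

Lemma st_move_can (dim : nat) (x : Zd dim) t :
  cancel (st_move x t) (st_move (- x) (- t)).
Proof. by move=> [s y]; rewrite /st_move /= !addrK. Qed.

Lemma st_move_can' (dim : nat) (x : Zd dim) t :
  cancel (st_move (- x) (- t)) (st_move x t).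
Proof. by move=> [s y]; rewrite /st_move /= !subrK. Qed.

Lemma st_move_wanders (dim : nat) (x : Zd dim) t : (x, t) != (0, 0) ->
  forall i j, exists N, forall n, (N <= n)%N -> iter n (st_move x t) i != j.
Proof.
have int_wanders (a b c : int) : c != 0 ->
    exists N, forall n, (N <= n)%N -> a + c *+ n != b.
  (* A hit at time [n] forces |b - a| = |c| n >= n. *)
  move=> c0; exists (absz (b - a)).+1 => n hn; apply/eqP => E.
  have : (absz (b - a) = absz c * n)%N.
    by rewrite -E addrAC subrr add0r pmulrn mulrzz abszM.
  by move: hn c0; rewrite -absz_gt0; nia.
have itE n s y : iter n (st_move x t) (s, y) = (s + t *+ n, y + x *+ n).
  elim: n => [|n IH]; first by rewrite !mulr0n !addr0.
  by rewrite iterS IH /st_move /= -!addrA -!mulrSr.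
move=> xt [s y] [s' y'].
have [t0|t0] := eqVneq t 0; last first.
  have [N hN] := int_wanders s s' t t0; exists N => n /hN; rewrite itE.
  by apply: contraNneq => -[->].
have [k xk] : exists k, x ord0 k != 0.
  apply/existsP; apply: contraNT xt; rewrite negb_exists => /forallP h.
  rewrite t0 xpair_eqE eqxx andbT; apply/eqP/rowP => k.
  by rewrite mxE; apply/eqP; have := h k; rewrite negbK.
have [N hN] := int_wanders (y ord0 k) (y' ord0 k) (x ord0 k) xk.
exists N => n /hN; rewrite itE; apply: contraNneq => -[_ <-].
rewrite mxE; apply/eqP; congr (_ + _).
by elim: n => [|n IH]; rewrite ?mulr0n ?mxE// !mulrS mxE IH.
Qed.

(** * Convergence, dynamics and ergodicity for i.i.d. noise *)

Section Noise.
Context {R : realType} {dim : nat} (p : Zd dim -> R).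
Context {dT : measure_display} {T : measurableType dT} (P : probability T R).
Variable xi : int -> Zd dim -> T -> R.
Hypothesis hp : good_kernel p.
Hypothesis mxi : forall t x, measurable_fun setT (xi t x).
Let X (j : int * Zd dim) := xi j.1 j.2.
Hypothesis iX : mutually_independent P X.
Hypothesis dX : identically_distributed P X.
Hypothesis X1 : forall t x, P.-integrable setT (EFin \o xi t x) /\
  (\int[P]_w (xi t x w)%:E = 0)%E.
Hypothesis X2 : forall t x, P.-integrable setT (fun w => (xi t x w ^+ 2)%:E).

Let mX j : measurable_fun setT (X j). Proof. exact: mxi. Qed.

Section Layers.
Variables (t : int) (x y : Zd dim).

Let v : R := (\int[P]_w (X (0, 0) w ^+ 2))%R.

Let v_ge0 : 0 <= v.
Proof. by apply: Rintegral_ge0 => w _; exact: sqr_ge0. Qed.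

(** Flattens layers [m] to [m + n - 1] into one list of pairs, each naming a different noise
    variable, so that a block of layers is a single linear combination of orthogonal variables. *)
Let window m n : seq (nat * Zd dim) :=
  [seq (k, z) | k <- iota 0 n, z <- dsupp p (m + k) x y].

Let window_uniq m n : uniq (window m n).
Proof.
apply: allpairs_uniq_dep; first exact: iota_uniq.
  by move=> k _; exact: fset_uniq.
by move=> [k z] [l u] _ _ /= [-> ->].
Qed.

Let layers_lincomb m n w : \sum_(k < n) layer p xi t x y (m + k) w =
  \sum_(j <- window m n) dcoef p (m + j.1) x y j.2 * X (t - (m + j.1)%:Z, j.2) w.
Proof.
rewrite big_allpairs_dep -(big_mkord xpredT (fun k => layer p xi t x y (m + k) w)).
by rewrite /index_iota subn0; apply: eq_bigr => k _; rewrite (layerE hp).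
Qed.

Lemma layers_sqint m n : sqint P (fun w => \sum_(k < n) layer p xi t x y (m + k) w).
Proof.
under eq_fun do rewrite layers_lincomb.
by apply: (lincomb_sqint (X := X)) => // j; exact: X2.
Qed.

Lemma layers_variance m n :
  (\int[P]_w ((\sum_(k < n) layer p xi t x y (m + k) w) ^+ 2) =
   \sum_(k < n) v * pk_energy p (m + k) x y)%R.
Proof.
under eq_Rintegral do rewrite layers_lincomb.
rewrite (@lincomb_variance _ _ _ P _ X mX iX dX _ _ _ _
  (fun j => dcoef p (m + j.1) x y j.2) (fun j => (t - (m + j.1)%:Z, j.2)) (0, 0))//.
- rewrite -mulr_sumr big_allpairs_dep -(big_mkord xpredT (fun k => pk_energy p (m + k) x y)).
  congr (_ * _); rewrite /index_iota subn0; apply: eq_bigr => k _.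
  by rewrite -(dsupp_energy hp).
- by move=> j; exact: X1.
- by move=> j; exact: X2.
- by move=> [k z] [l u] /= [h ->]; congr (_, _); lia.
Qed.

Lemma layers_indep m k : indep_fields P
  (fun w i => layer p xi t x y (m + minn i k) w)
  (fun w j => layer p xi t x y (m + (k.+1 + j)) w).
Proof.
have ib := @indep_blocks _ _ _ P _ X mX iX (nat * Zd dim)%type (nat * Zd dim)%type
  (fun j => (t - (m + minn j.1 k)%:Z, j.2))
  (fun j => (t - (m + (k.+1 + j.1))%:Z, j.2)).
(* [comb] rebuilds the layers from the noise they read, reducing their independence to that of two
   noise blocks with times at least [t - (m + k)] and strictly before it. *)
pose comb (h : nat -> nat) (f : nat * Zd dim -> R) i :=
  \sum_(z <- dsupp p (h i) x y) dcoef p (h i) x y z * f (i, z).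
have mcomb h A : cyl_sigma A -> cyl_sigma (comb h @^-1` A).
  apply: cyl_map => i; apply: measurable_sum => z; apply: measurable_funM => //.
  exact: cyl_eval.
have := indep_fields_comp (ib _) (mcomb (fun i => m + minn i k)%N)
  (mcomb (fun j => m + (k.+1 + j))%N).
have E (h : nat -> nat) :
    (fun w i => layer p xi t x y (h i) w) =
    comb h \o (fun w j => X (t - (h j.1)%:Z, j.2) w).
  by apply/funext => w; apply/funext => i; rewrite (layerE hp).
rewrite -(E (fun i => m + minn i k)%N) -(E (fun j => m + (k.+1 + j))%N); apply.
by move=> i j; apply/eqP => -[h _]; have := geq_minr i.1 k; lia.
Qed.

Lemma Delta_as_cvg : {ae P, forall w, cvgn (fun n => Delta_partial p xi t x y n w)}.
Proof.
have [C hC] := summable_energyT hp x y.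
apply: (@as_cvg_series _ _ _ P (layer p xi t x y) _ _ (fun k => v * pk_energy p k x y) (v * C)).
- by move=> k; exact: layer_measurable.
- exact: layers_indep.
- by move=> k; rewrite mulr_ge0// pk_energy_ge0.
- by move=> n; rewrite -mulr_sumr ler_wpM2l.
- exact: layers_sqint.
- by move=> m n; rewrite layers_variance.
Qed.

Lemma Delta_l2_cvg :
  (fun n => (\int[P]_w ((Delta_partial p xi t x y n w - Delta p xi t x y w) ^+ 2)%:E)%E)
    @ \oo --> 0%E.
Proof.
have [C hC] := summable_energyT hp x y.
apply: (@l2_cvg_series _ _ _ P (layer p xi t x y) _ (fun k => v * pk_energy p k x y) (v * C)).
- by move=> k; exact: layer_measurable.
- by move=> k; rewrite mulr_ge0// pk_energy_ge0.
- by move=> n; rewrite -mulr_sumr ler_wpM2l.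
- exact: layers_sqint.
- by move=> m n; rewrite layers_variance.
- exact: Delta_as_cvg.
Qed.

End Layers.

Lemma Delta_all_cvg :
  {ae P, forall w, forall t x y, cvgn (fun n => Delta_partial p xi t x y n w)}.
Proof.
have h := @ae_forall_count _ _ _ P (int * Zd dim * Zd dim)%type
  (fun j w => cvgn (fun n => Delta_partial p xi j.1.1 j.1.2 j.2 n w))
  (fun j => Delta_as_cvg j.1.1 j.1.2 j.2).
by apply: filterS h => w hw t x y; exact: (hw (t, x, y)).
Qed.

Lemma Delta_add t x y z w :
  (forall t x y, cvgn (fun n => Delta_partial p xi t x y n w)) ->
  Delta p xi t x y w + Delta p xi t y z w = Delta p xi t x z w.
Proof.
move=> hw; rewrite /Delta -limD//; congr (limn _); apply/funext => n.
exact: Delta_partial_add.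
Qed.

Lemma Delta_evolution t x y w :
  (forall t x y, cvgn (fun n => Delta_partial p xi t x y n w)) ->
  Delta p xi (t + 1) x y w =
    \sum_(z \in [set: Zd dim]) p z * Delta p xi t (x + z) (y + z) w
    + xi (t + 1) y w - xi (t + 1) x w.
Proof.
move=> hw; apply: cvg_lim => //.
(* Dropping the first term aligns the sequence with the extra layer of the finite identity; the sum
   over the finite support of [p] then commutes with the limit. *)
rewrite -cvg_shiftS; under eq_cvg do rewrite /= (Delta_partial_evolution hp).
rewrite (kernel_sumE hp); apply: cvgB; last exact: cvg_cst.
apply: cvgD; last exact: cvg_cst.
apply: cvg_big => [|z _]; first exact: add_continuous.
by apply: cvgMr; exact: hw.
Qed.

Lemma Delta_past_indep t : indep_fields P
  (fun w (j : nat * Zd dim * 'I_dim) =>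
     Delta_field p xi w (t - j.1.1%:Z, j.1.2, j.2))
  (fun w (y : Zd dim) => xi (t + 1) y w).
Proof.
have ib := @indep_blocks _ _ _ P _ X mX iX (nat * Zd dim)%type (Zd dim)
  (fun j => (t - j.1%:Z, j.2)) (fun y => (t + 1, y)).
(* The past is indexed by elapsed time. For [s] beyond [t] the absolute value reads a meaningless
   entry, which Delta at times up to [t] never uses. *)
pose past s z (f : cylT (R := R) (nat * Zd dim)%type) := f (absz (t - s), z).
pose G (f : nat * Zd dim -> R) (j : nat * Zd dim * 'I_dim) : R :=
  Delta p past (t - j.1.1%:Z) (j.1.2 - unitv j.2) j.1.2 f.
have mG A : cyl_sigma A -> cyl_sigma (G @^-1` A).
  apply: cyl_map => j; apply: (Delta_measurable hp) => s z; exact: cyl_eval.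
have := indep_fields_comp (ib _) mG (g := id) (fun A mA => mA).
rewrite (_ : G \o _ = fun w (j : nat * Zd dim * 'I_dim) =>
    Delta_field p xi w (t - j.1.1%:Z, j.1.2, j.2)).
  apply; move=> i j; apply/eqP => -[h _]; lia.
apply/funext => w; apply/funext => j; apply: eq_Delta => k z.
by rewrite /past /X /=; congr (xi _ _ _); lia.
Qed.

Lemma Delta_field_invariant x t A : cyl_sigma A ->
  P (Delta_field p xi @^-1` A) = P ((st_shift x t \o Delta_field p xi) @^-1` A).
Proof.
move=> mA; have := shift_law mX iX dX (st_move_can x t) (st_move_can' x t) (Phi_cyl hp mA).
move=> /esym; congr (P _ = P _).
by apply/seteqP; split=> w /=; rewrite -(Phi_shift hp x t (fun j => X j w)).
Qed.

Lemma Delta_field_ergodic x t A : (x, t) != (0, 0) -> cyl_sigma A ->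
  st_shift x t @^-1` A = A ->
  P (Delta_field p xi @^-1` A) = 0%E \/ P (Delta_field p xi @^-1` A) = 1%E.
Proof.
move=> xt mA invA.
apply: (shift_ergodic mX iX dX (st_move_can x t) (st_move_can' x t)
  (st_move_wanders xt) (Phi_cyl hp mA)) => f.
by rewrite /preimage /= (Phi_shift hp) -[in X in _ <-> X]invA.
Qed.

End Noise.
Theorem theorem2p2 (R : realType) (dim : nat) (p : Zd dim -> R)
  (dT : measure_display) (T : measurableType dT) (P : probability T R)
  (xi : int -> Zd dim -> T -> R) :
  good_kernel p ->
  (forall t x, measurable_fun setT (xi t x)) ->
  mutually_independent P (fun j : int * Zd dim => xi j.1 j.2) ->
  identically_distributed P (fun j : int * Zd dim => xi j.1 j.2) ->
  (forall t x, P.-integrable setT (EFin \o xi t x) /\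
               (\int[P]_w (xi t x w)%:E = 0)%E) ->
  (forall t x, P.-integrable setT (fun w => (xi t x w ^+ 2)%:E)) ->
  (* almost sure convergence of the series *)
  {ae P, forall w, forall t x y, cvgn (fun n => Delta_partial p xi t x y n w)}
  /\
  (* L^2 convergence (to the same limit) *)
  (forall t x y,
     (fun n => (\int[P]_w ((Delta_partial p xi t x y n w - Delta p xi t x y w) ^+ 2)%:E)%E)
       @ \oo --> 0%E)
  /\
  (* additivity and evolution equation *)
  {ae P, forall w,
     (forall t x y z, Delta p xi t x y w + Delta p xi t y z w = Delta p xi t x z w) /\
     (forall t x y, Delta p xi (t + 1) x y w =
        \sum_(z \in [set: Zd dim]) p z * Delta p xi t (x + z) (y + z) w
        + xi (t + 1) y w - xi (t + 1) x w)}
  /\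
  (* Delta_t is a version of the Markov chain eta_t: recursion ... *)
  {ae P, forall w, forall t x (i : 'I_dim),
     Delta_field p xi w (t + 1, x, i) =
       \sum_(z \in [set: Zd dim]) p z * Delta_field p xi w (t, x + z, i)
       + xi (t + 1) x w - xi (t + 1) (x - unitv i) w}
  /\
  (* ... driven by xi_{t+1}, independent of the past (Delta_s)_{s <= t} *)
  (forall t : int,
     indep_fields P
       (fun w (j : nat * Zd dim * 'I_dim) => Delta_field p xi w (t - j.1.1%:Z, j.1.2, j.2))
       (fun w (y : Zd dim) => xi (t + 1) y w))
  /\
  (* invariance (hence stationarity, taking x = 0) and ergodicity of the
     field {Delta_t(x)} under each space-time shift theta_{x,t} <> id *)
  (forall (x : Zd dim) (t : int), (x, t) != (0, 0) ->
     (forall A, @cyl_sigma R _ A ->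
        P (Delta_field p xi @^-1` A) = P ((st_shift x t \o Delta_field p xi) @^-1` A))
     /\
     (forall A, @cyl_sigma R _ A -> st_shift x t @^-1` A = A ->
        P (Delta_field p xi @^-1` A) = 0%E \/ P (Delta_field p xi @^-1` A) = 1%E)).
Proof.
move=> hp mxi iX dX X1 X2.
have cv := Delta_all_cvg hp mxi iX dX X1 X2.
split=> //; split; first by move=> t x y; exact: Delta_l2_cvg.
split.
  apply: filterS cv => w hw; split=> [t x y z|t x y]; first exact: Delta_add.
  exact: Delta_evolution.
split.
  apply: filterS cv => w hw t x i; rewrite /Delta_field /=.
  rewrite (Delta_evolution hp)//; congr (_ + _ - _).
  by apply: eq_fsbigr => z _; rewrite addrAC.
split; first by move=> t; exact: Delta_past_indep.
move=> x t xt; split=> A mA; first exact: Delta_field_invariant.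
exact: Delta_field_ergodic.
Qed.
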